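(* Let $H=L^2(\mathbb R)$, let $S=(S_t)_{t\in\mathbb R}$ be the group of shifts $(S_t\eta)(x)=\eta(x+t)$, let $H_{0]}$ and $H_{[0}$ be the subspaces of functions in $H$ supported in $[0,+\infty)$ and $(-\infty,0]$ respectively, and let $T_t=S_{-t}|_{H_{0]}}$, $t\ge 0$, be the semigroup of right shifts. Let $\mathcal V=M_\Theta H_{0]}$ be a subspace of $H_{0]}$ invariant with respect to $T$, where $\Theta$ is an inner function, and let $\mathcal V^\perp$ be its orthogonal complement in $H_{0]}$. Let $R=(R_t)_{t\in\mathbb R_+}$ be a strongly continuous semigroup of unitaries in $\mathcal V^\perp$. Then the family of unitary operators $(W_t)_{t\in\mathbb R}$ defined for negative times by $$W_{-t}\eta=(R_tP_{\mathcal V^\perp}S_t-P_{\mathcal V})P_{[t,+\infty)}\eta+M_\Theta P_{[0,t]}\eta,\quad \eta\in H_{0]},$$ $$W_{-t}\eta=\eta,\quad \eta\in H_{[0},\qquad t\ge 0,$$ and extended to positive times by $W_t=S_tW_{-t}^*S_{-t}$, $t\ge 0$, is a Markovian cocycle (for the group $S$) such that $$\lim_{t\to+\infty}W_{-t}\eta=M_\Theta\eta,\quad \eta\in H_{0]}.$$ The semigroup $R$ determines the unitary part, in the sense of the Wold decomposition, of the semigroup of isometries $(W_{-t}T_t)_{t\in\mathbb R_+}$ in $H_{0]}$.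
   Context: $P_{[0,t]}$, $P_{[t,+\infty)}$, $P_{\mathcal V}$, $P_{\mathcal V^\perp}$ are the orthogonal projections onto the functions supported in $[0,t]$, onto the functions supported in $[t,+\infty)$, onto $\mathcal V$ and onto $\mathcal V^\perp$. A function $\Theta(\lambda)$ is inner if it is analytic in the half-plane $\operatorname{Re}\lambda\ge 0$ and its modulus equals one on the imaginary axis. $M_\Theta=\mathcal L^{-1}\Theta\mathcal L$ is the isometric operator on $H_{0]}=L^2(\mathbb R_+)$, where $\mathcal L$ is the Laplace transformation and $\Theta$ stands for multiplication by the function $\Theta$. Every $T$-invariant subspace of $H_{0]}$ can be described as the image $M_\Theta H_{0]}$ of such an operator. The group $S$ is associated with the process $\xi_t=\chi_{[-t,0]}$ with noncorrelated increments, $\xi_{t+s}=\xi_t+S_t\xi_s$. Let $H_{[t}$ (the future after $t$) be the subspace generated by the increments $\xi_s-\xi_r$, $s,r\ge t$, i.e. the functions supported in $(-\infty,-t]$. A (multiplicative) $S$-cocycle is a strongly continuous family of unitaries $W=(W_t)_{t\in\mathbb R}$ in $H$ with $W_0=I$ and $W_{t+s}=W_tS_tW_sS_t^*$ for $s,t\in\mathbb R$; it is Markovian if $W_tf=f$ for $f\in H_{[t}$, $t>0$. Wold decomposition: for a strongly continuous semigroup of isometries in a Hilbert space $K$, the decomposition $K=K^{(1)}\oplus K^{(2)}$ into subspaces reducing the semigroup to a semigroup of unitary operators (the unitary part) and to a semigroup of completely nonunitary isometries, respectively.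
   Formalization: The term −P_V in the formula for W_{-t} is replaced by S_{-t}P_V S_t: as printed, W_0 = P_{V^⊥} − P_V on H_{0]}, which is never the identity since V ≠ 0, so W would not be a cocycle. *)

(* Defs.v *)
From HB Require Import structures.
From mathcomp Require Import all_boot all_order all_algebra.
From mathcomp Require Import ring_quotient complex.
From mathcomp Require Import all_classical all_reals all_analysis.

Set Implicit Arguments.
Unset Strict Implicit.
Unset Printing Implicit Defensive.
Import Order.TTheory GRing.Theory Num.Theory.
Import numFieldTopology.Exports numFieldNormedType.Exports.

Local Open Scope classical_set_scope.
Local Open Scope ring_scope.
Local Open Scope complex_scope.

Section L2fun.
Context (R : realType).
Local Notation mu := (@lebesgue_measure R).

Definition L2pred : {pred R -> R[i]} := fun f =>
  ((fun x => complex.Re (f x)) \in Lfun mu 2%:E) &&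
  ((fun x => complex.Im (f x)) \in Lfun mu 2%:E).

Lemma L2pred_submod_closed : submod_closed L2pred.
Proof.
have two : (1 <= 2%:E :> \bar R)%E by rewrite lee_fin ler1n.
have L0 : (fun _ : R => 0 : R) \in Lfun mu 2%:E by exact: (rpred0 (Lfun mu 2%:E)).
have LD f g : f \in Lfun mu 2%:E -> g \in Lfun mu 2%:E ->
    (fun x => f x + g x) \in Lfun mu 2%:E.
  exact: (@rpredD _ (Lfun mu 2%:E)).
have LB f g : f \in Lfun mu 2%:E -> g \in Lfun mu 2%:E ->
    (fun x => f x - g x) \in Lfun mu 2%:E.
  exact: (@rpredB _ (Lfun mu 2%:E)).
have LZ (a : R) f : f \in Lfun mu 2%:E -> (fun x => a * f x) \in Lfun mu 2%:E.
  exact: (@rpredZ _ _ (Lfun mu 2%:E)).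
split; first by apply/andP; split; exact: L0.
move=> [a b] f g /andP[rf imf] /andP[rg img].
have E x : (a +i* b *: f + g) x = a +i* b * f x + g x by [].
apply/andP; split.
- have -> : (fun x => complex.Re ((a +i* b *: f + g) x)) =
      fun x => a * complex.Re (f x) - b * complex.Im (f x) + complex.Re (g x).
    by apply/funext => x; rewrite E; case: (f x) (g x) => [? ?] [].
  by apply: LD => //; apply: LB; exact: LZ.
- have -> : (fun x => complex.Im ((a +i* b *: f + g) x)) =
      fun x => a * complex.Im (f x) + b * complex.Re (f x) + complex.Im (g x).
    by apply/funext => x; rewrite E; case: (f x) (g x) => [? ?] [].
  by apply: (LD) => //; apply: LD; exact: LZ.
Qed.

HB.instance Definition _ :=
  GRing.isSubmodClosed.Build _ _ L2pred L2pred_submod_closed.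

Record L2fun := MkL2fun { L2fun_val :> R -> R[i]; L2funP : L2fun_val \in L2pred }.

HB.instance Definition _ := [isSub for L2fun_val].
HB.instance Definition _ := [Choice of L2fun by <:].
HB.instance Definition _ := [SubChoice_isSubLmodule of L2fun by <:].

Definition null_pred : {pred L2fun} := fun f =>
  `[< {ae mu, forall x, (f : R -> R[i]) x = 0} >].

Lemma null_pred_submod_closed : submod_closed null_pred.
Proof.
split; first by apply/asboolP; apply: aeW.
move=> a f g /asboolP f0 /asboolP g0; apply/asboolP.
apply: (@filterS2 _ _ (ae_filter_ringOfSetsType mu) _ _ _ _ f0 g0) => x fx gx.
by rewrite -[LHS]/(a * f x + g x) fx gx mulr0 addr0.
Qed.

HB.instance Definition _ :=
  GRing.isSubmodClosed.Build _ _ null_pred null_pred_submod_closed.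

Definition L2 : Type := {ideal_quot null_pred}.

HB.instance Definition _ := GRing.Zmodule.on L2.
HB.instance Definition _ := EqQuotient.on L2.

Let pi_L2D (f g : L2fun) : (\pi_L2 f + \pi_L2 g = \pi_L2 (f + g))%qT.
Proof. by symmetry; exact: (@Quotient.pi_add _ null_pred f g). Qed.

Definition L2scale (a : R[i]) : L2 -> L2 := lift_op1 L2 ( *:%R a).

Lemma pi_L2scale a : {morph \pi_L2 : f / a *: f >-> L2scale a f}%qT.
Proof.
move=> f; unlock L2scale; apply/eqP.
rewrite -Quotient.idealrBE -scalerBr rpredZ//.
by rewrite Quotient.idealrBE reprK.
Qed.

Let scaleA a b f : L2scale a (L2scale b f) = L2scale (a * b) f.
Proof. by rewrite -[f]reprK -!pi_L2scale scalerA. Qed.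

Let scale1 : left_id 1 L2scale.
Proof. by move=> f; rewrite -[f]reprK -!pi_L2scale scale1r. Qed.

Let scaleDr : right_distributive L2scale +%R.
Proof.
move=> a f g; rewrite -[f]reprK -[g]reprK.
by rewrite pi_L2D -!pi_L2scale pi_L2D scalerDr.
Qed.

Let scaleDl f : {morph L2scale^~ f : a b / a + b}.
Proof.
by move=> a b; rewrite -[f]reprK -!pi_L2scale pi_L2D scalerDl.
Qed.

HB.instance Definition _ :=
  GRing.Zmodule_isLmodule.Build R[i] L2 scaleA scale1 scaleDr scaleDl.
End L2fun.

Section HilbertSpace.
Context {R : realType}.
Local Notation mu := (@lebesgue_measure R).
Local Notation H := (L2 R).
Implicit Types (f g h : H) (K L : set H) (A : H -> H) (J : R -> H -> H).

Definition rep h : R -> R[i] := (repr h : L2fun R).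

(* Junk value 0 when [u] is not square integrable. *)
Definition toL2 (u : R -> R[i]) : H :=
  (\pi_(L2 R) (insubd (0 : L2fun R) u))%qT.

Definition cintegral (D : set R) (u : R -> R[i]) : R[i] :=
  (\int[mu]_(x in D) complex.Re (u x)) +i* (\int[mu]_(x in D) complex.Im (u x)).

Definition dot f g : R[i] := cintegral setT (fun x => rep f x * (rep g x)^*).

Definition hnorm h : R := Num.sqrt (complex.Re (dot h h)).

Definition closed_subspace K :=
  [/\ K 0,
      forall (a : R[i]) f g, K f -> K g -> K (a *: f + g) &
      forall h, (forall e : R, 0 < e -> exists2 k, K k & hnorm (h - k) < e) ->
        K h].

Definition ocompl K L : set H := [set h | K h /\ forall l, L l -> dot h l = 0].

Definition is_proj K h k := K k /\ forall l, K l -> dot (h - k) l = 0.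

Definition orth_proj K h : H := xget 0 [set k | is_proj K h k].

Definition adjoint A g : H :=
  xget 0 [set k | forall h, dot (A h) g = dot h k].

Definition isometry_on K A :=
  [/\ forall h, K h -> K (A h),
      forall (a : R[i]) f g, K f -> K g -> A (a *: f + g) = a *: A f + A g &
      forall h, K h -> hnorm (A h) = hnorm h].

Definition unitary_on K A :=
  isometry_on K A /\ forall k, K k -> exists2 h, K h & A h = k.

Definition strongly_continuous_on (I : set R) K J :=
  forall h, K h -> forall t, I t ->
    hnorm (J s h - J t h) @[s --> within I (nbhs t)] --> (0 : R).

Definition isometry_semigroup K J :=
  [/\ forall t, 0 <= t -> isometry_on K (J t),
      forall h, K h -> J 0 h = h,
      forall s t h, 0 <= s -> 0 <= t -> K h -> J (s + t) h = J s (J t h) &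
      strongly_continuous_on `[0, +oo[ K J].

Definition unitary_semigroup K J :=
  isometry_semigroup K J /\ forall t, 0 <= t -> unitary_on K (J t).

Definition reduces K L A :=
  [/\ L `<=` K,
      forall h, L h -> L (A h) &
      forall h, ocompl K L h -> ocompl K L (A h)].

Definition completely_nonunitary K J :=
  forall L, closed_subspace L -> (forall t, 0 <= t -> reduces K L (J t)) ->
    unitary_semigroup L J -> L = [set 0].

Record wold_decomposition K J K1 K2 : Prop := WoldDecomposition {
  wold_semigroup : isometry_semigroup K J;
  wold_closed1 : closed_subspace K1;
  wold_closed2 : closed_subspace K2;
  wold_orth : forall f g, K1 f -> K2 g -> dot f g = 0;
  wold_sum : K = [set f + g | f in K1 & g in K2];
  wold_reduces1 : forall t, 0 <= t -> reduces K K1 (J t);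
  wold_reduces2 : forall t, 0 <= t -> reduces K K2 (J t);
  wold_unitary : unitary_semigroup K1 J;
  wold_isometry : isometry_semigroup K2 J;
  wold_cnu : completely_nonunitary K2 J }.

Definition supported (D : set R) : set H :=
  [set h | {ae mu, forall x, ~ D x -> rep h x = 0}].

Definition Sshift (t : R) h : H := toL2 (fun x => rep h (x + t)).

(* H_{0]}: the increments of xi_t = chi_[-t,0] for t <= 0 generate the functions
   supported in the positive half-line, those after t the functions supported
   in ]-oo, -t]. *)
Definition past : set H := supported `[0, +oo[.

Definition future (t : R) : set H := supported `]-oo, (- t)].

Definition Tshift (t : R) : H -> H := Sshift (- t).

Record cocycle (W : R -> H -> H) : Prop := Cocycle {
  cocycle_unitary : forall t, unitary_on setT (W t);
  cocycle_continuous : strongly_continuous_on setT setT W;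
  cocycle0 : forall h, W 0 h = h;
  cocycleD : forall t s h,
    W (t + s) h = W t (Sshift t (W s (adjoint (Sshift t) h))) }.

Definition markovian_cocycle (W : R -> H -> H) :=
  cocycle W /\ forall t, 0 < t -> forall f, future t f -> W t f = f.

Definition cexp (z : R[i]) : R[i] :=
  (expR (complex.Re z) * cos (complex.Im z)) +i*
  (expR (complex.Re z) * sin (complex.Im z)).

Definition laplace h (l : R[i]) : R[i] :=
  cintegral `[0, +oo[ (fun x => cexp (- (l * x%:C)) * rep h x).

Definition inner_function (Theta : R[i] -> R[i]) :=
  (forall z : R[i], 0 <= complex.Re z ->
     \forall w \near (z : R[i]^o), derivable (Theta : R[i]^o -> R[i]^o) w 1) /\
  (forall z : R[i], complex.Re z = 0 -> `|Theta z| = 1).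

(* M is the isometric operator L^-1 Theta L on H_{0]}. By injectivity of the
   Laplace transformation Theta determines M on H_{0]}; the values of M outside
   of H_{0]} are irrelevant. Not every function satisfying [inner_function] has
   such an M: multiplication by e^l does not preserve the image of H_{0]}. *)
Definition multiplier (Theta : R[i] -> R[i]) (M : H -> H) :=
  isometry_on past M /\
  forall h, past h -> forall l, 0 < complex.Re l ->
    laplace (M h) l = Theta l * laplace h l.

(* W_{-t} on H_{0]} for t >= 0:
   W_{-t} = (U_t P_{V^perp} S_t + S_{-t} P_V S_t) P_[t,+oo[ + M_Theta P_[0,t].
   With - P_V in place of the term S_{-t} P_V S_t, W_0 would be P_{V^perp} - P_V
   on H_{0]}, not the identity; on S_{-t} V this term is forced by the cocycle
   identity together with W_{-t} = M_Theta on the functions supported in [0,t]. *)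
Definition Wpast (M : H -> H) (U : R -> H -> H) (t : R) h : H :=
  let V := M @` past in
  let p := orth_proj (supported `[t, +oo[) h in
  U t (orth_proj (ocompl past V) (Sshift t p))
  + Sshift (- t) (orth_proj V (Sshift t p))
  + M (orth_proj (supported `[0, t]) h).

(* Linear extension by the identity on H_{[0} = [future 0]. *)
Definition Wneg (M : H -> H) (U : R -> H -> H) (t : R) h : H :=
  Wpast M U t (orth_proj past h) + orth_proj (future 0) h.

Definition Wfam (M : H -> H) (U : R -> H -> H) (t : R) : H -> H :=
  if t <= 0 then Wneg M U (- t)
  else fun h => Sshift t (adjoint (Wneg M U t) (Sshift (- t) h)).

End HilbertSpace.

(* Main.v *)
From HB Require Import structures.
Require Import Defs.
From mathcomp Require Import all_boot all_order all_algebra.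
From mathcomp Require Import complex ring_quotient ring lra.
From mathcomp Require Import all_classical all_reals all_analysis.
From mathcomp Require Import measurable_realfun.
Set Implicit Arguments.
Unset Strict Implicit.
Unset Printing Implicit Defensive.
Import Order.TTheory GRing.Theory Num.Theory.
Import numFieldTopology.Exports numFieldNormedType.Exports.
Local Open Scope classical_set_scope.
Local Open Scope ring_scope.

(** W_{-t} S_{-t} is a semigroup: extend M_Theta by the identity on H_{[0} to an
    isometry Mext of H.  Its range is the orthogonal complement of Vperp in H,
    and W_{-t} S_{-t} is the orthogonal sum of R_t on Vperp and of the transported
    shift Mext S_{-t} Mext^{-1} on the range of Mext; the formula for W_{-t} uses
    that M_Theta commutes with right shifts.  Hence W_t S_t, for t in R, is a
    strongly continuous one-parameter group of unitaries, which is the cocycle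
    identity.  On H_{0]} the semigroup W_{-t} T_t is R_t on Vperp and T_t on V,
    and T has no unitary part because functions in all the T_t H_{0]} vanish.

    Commutation of M_Theta with shifts follows from the injectivity of the
    Laplace transformation: if the transform of h vanishes at the points 1, 2, ...,
    summing the exponential series shows that e^{-x} h(x) is orthogonal to
    exp(- e^{- n (x - a)}), which tends to the indicator of ]a, +oo[ as n grows.

    Strong continuity of shifts and the decay of tails are checked on indicators
    of intervals, which are total by the Lebesgue differentiation theorem. *)

(** * Square integrable functions and their classes *)

(** For positive times [W_t] is given by [adjoint], which is picked by choice; it is computed here
    from the surjectivity of [W_{-t} S_{-t}]. Two facts give surjectivity: [R_t] maps Vperp onto
    itself, and on the range of [Mext] the operator is a transported shift of the whole line. On V
    alone the right shift misses functions; adjoining the negative half-line makes it invertible.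
    The cocycle identity for times of mixed signs then follows by applying [W_{-c} S_{-c}], with c
    large, to both sides: this moves all times into the semigroup, and the operator applied is
    injective.

    The projections onto V and Vperp have no explicit formula, unlike those onto functions with a
    given support. Their existence rests on the projection theorem, hence on the completeness of the
    quotient space, which is why Riesz-Fischer is proved first. *)

Section L2basics.
Context {R : realType}.
Local Notation mu := (@lebesgue_measure R).
Local Notation H := (L2 R).
Local Notation Re := (@complex.Re R).
Local Notation Im := (@complex.Im R).

Lemma ae_imp (P Q : R -> Prop) : (forall x, P x -> Q x) ->
  {ae mu, forall x, P x} -> {ae mu, forall x, Q x}.
Proof. exact: (@filterS _ _ (ae_filter_ringOfSetsType mu)). Qed.

Lemma ae_imp2 (P1 P2 Q : R -> Prop) : (forall x, P1 x -> P2 x -> Q x) ->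
  {ae mu, forall x, P1 x} -> {ae mu, forall x, P2 x} -> {ae mu, forall x, Q x}.
Proof. exact: (@filterS2 _ _ (ae_filter_ringOfSetsType mu)). Qed.

Lemma ae_imp3 (P1 P2 P3 Q : R -> Prop) : (forall x, P1 x -> P2 x -> P3 x -> Q x) ->
  {ae mu, forall x, P1 x} -> {ae mu, forall x, P2 x} -> {ae mu, forall x, P3 x} ->
  {ae mu, forall x, Q x}.
Proof. exact: (@filterS3 _ _ (ae_filter_ringOfSetsType mu)). Qed.

Lemma ae_imp4 (P1 P2 P3 P4 Q : R -> Prop) :
  (forall x, P1 x -> P2 x -> P3 x -> P4 x -> Q x) ->
  {ae mu, forall x, P1 x} -> {ae mu, forall x, P2 x} -> {ae mu, forall x, P3 x} ->
  {ae mu, forall x, P4 x} -> {ae mu, forall x, Q x}.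
Proof.
move=> PQ h1 h2 h3 h4.
have h12 := ae_imp2 (fun x => @conj (P1 x) (P2 x)) h1 h2.
by apply: ae_imp3 h12 h3 h4 => x [? ?]; exact: PQ.
Qed.

Lemma Lfun2P (f : R -> R) : f \in Lfun mu 2%:E <->
  measurable_fun setT f /\ mu.-integrable setT (EFin \o (fun x => f x ^+ 2)).
Proof.
split=> [fL|[mf /integrableP[_ intf]]].
  split; last exact: Lfun2_integrable_sqr.
  by move: fL; rewrite inE => /andP[/[!inE]].
rewrite inE; apply/andP; split; rewrite inE//= /finite_norm unlock.
apply: poweR_lty; apply: le_lt_trans intf.
apply: ge0_le_integral => //.
- by move=> *; exact: poweR_ge0.
- apply: (measurableT_comp (measurable_poweR _)) => //.
  by apply: measurableT_comp => //; exact/measurable_EFinP.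
- by apply: measurableT_comp => //; apply/measurable_EFinP; exact: measurable_funX.
- move=> t _ /=; rewrite lee_fin powR_mulrn// real_normK ?num_real//.
  by rewrite ger0_norm ?sqr_ge0.
Qed.

(** The norm of [R[i]] takes its values in [R[i]]; this one is real, and polynomial in the two
    parts. *)
Definition sqmod (z : R[i]) : R := Re z ^+ 2 + Im z ^+ 2.

Lemma sqmod_ge0 z : 0 <= sqmod z.
Proof. by rewrite addr_ge0// sqr_ge0. Qed.

Lemma sqmod_eq0 z : (sqmod z == 0) = (z == 0).
Proof.
by rewrite paddr_eq0 ?sqr_ge0// !sqrf_eq0 eq_complex.
Qed.

(* Subsets of the line are typed over [measurableTypeR R], where Lebesgue measure
   lives; the default measurable structure of [R] has another display. *)
Definition cmeas (u : R -> R[i]) :=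
  measurable_fun setT (Re \o u) /\ measurable_fun setT (Im \o u).

Lemma L2predP (u : R -> R[i]) : u \in @L2pred R <->
  cmeas u /\ mu.-integrable setT (EFin \o (sqmod \o u)).
Proof.
split=> [/andP[/Lfun2P[mr ir] /Lfun2P[mi ii]]|[[mr mi] isq]].
  split; first by split.
  by rewrite /sqmod; exact: (integrableD _ ir ii).
apply/andP; split; apply/Lfun2P; split=> //; apply: le_integrable isq => //.
- by apply/measurable_EFinP; apply: measurable_funX.
- move=> x _ /=; rewrite lee_fin !ger0_norm ?sqr_ge0 ?sqmod_ge0//.
  by rewrite lerDl sqr_ge0.
- by apply/measurable_EFinP; apply: measurable_funX.
- move=> x _ /=; rewrite lee_fin !ger0_norm ?sqr_ge0 ?sqmod_ge0//.
  by rewrite lerDr sqr_ge0.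
Qed.

Lemma rep_in (h : H) : rep h \in @L2pred R.
Proof. exact: L2funP. Qed.

Lemma rep_cmeas (h : H) : cmeas (rep h).
Proof. by have /L2predP[] := rep_in h. Qed.

Lemma pi_L2P (f g : L2fun R) : (\pi_(L2 R) f = \pi_(L2 R) g)%qT <->
  {ae mu, forall x, (f : R -> R[i]) x = g x}.
Proof.
have -> : (\pi_(L2 R) f = \pi_(L2 R) g)%qT <-> f - g \in @null_pred R.
  by rewrite Quotient.idealrBE; split=> [?|/eqP//]; apply/eqP.
split=> [/asboolP|fg].
  apply: ae_imp => x /eqP.
  by rewrite -[X in X == 0]/((f : R -> R[i]) x - (g : R -> R[i]) x) subr_eq0 => /eqP.
apply/asboolP; apply: ae_imp fg => x fg.
by rewrite -[LHS]/((f : R -> R[i]) x - (g : R -> R[i]) x) fg subrr.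
Qed.

Lemma L2_eqP (f g : H) : f = g <-> {ae mu, forall x, rep f x = rep g x}.
Proof. by rewrite -pi_L2P !reprK. Qed.

Lemma rep_toL2 (u : R -> R[i]) : u \in @L2pred R ->
  {ae mu, forall x, rep (toL2 u) x = u x}.
Proof.
move=> uL; have := insubdK (0 : L2fun R) uL.
rewrite /rep /toL2; set v := insubd _ _ => vu.
have /pi_L2P : (\pi_(L2 R) (repr (\pi_(L2 R) v)) = \pi_(L2 R) v)%qT.
  by rewrite reprK.
by apply: ae_imp => x ->; rewrite -vu.
Qed.

(** The chosen representative of a sum is not the sum of the chosen representatives. Equality almost
    everywhere is all that remains, so later pointwise computations collect such statements with
    [ae_imp]. *)
Lemma repL a (f g : H) :
  {ae mu, forall x, rep (a *: f + g) x = a * rep f x + rep g x}.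
Proof.
have -> : a *: f + g = (\pi_(L2 R) (a *: repr f + repr g))%qT.
  rewrite -{1}[f]reprK -{1}[g]reprK -[LHS]/(L2scale a _ + _).
  by rewrite -pi_L2scale; symmetry; exact: (@Quotient.pi_add _ (@null_pred R)).
have /pi_L2P : (\pi_(L2 R) (repr (\pi_(L2 R) (a *: repr f + repr g))) =
  \pi_(L2 R) (a *: repr f + repr g))%qT by rewrite reprK.
by apply: ae_imp => x; rewrite /rep => ->.
Qed.

Lemma repB (f g : H) : {ae mu, forall x, rep (f - g) x = rep f x - rep g x}.
Proof.
have := repL (-1) g f; rewrite scaleN1r addrC; apply: ae_imp => x ->.
by rewrite mulN1r addrC.
Qed.

Lemma rep0 : {ae mu, forall x, rep (0 : H) x = 0}.
Proof. by have := repB 0 0; rewrite subr0; apply: ae_imp => x ->; rewrite subrr. Qed.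

Lemma repZ a (f : H) : {ae mu, forall x, rep (a *: f) x = a * rep f x}.
Proof.
by have := repL a f 0; rewrite addr0; move: rep0; apply: ae_imp2 => x -> ->; rewrite addr0.
Qed.

End L2basics.

(** * The inner product *)

Section Dot.
Context {R : realType}.
Local Notation mu := (@lebesgue_measure R).
Local Notation H := (L2 R).
Local Notation Re := (@complex.Re R).
Local Notation Im := (@complex.Im R).

Lemma cReM (z w : R[i]) : Re (z * w) = Re z * Re w - Im z * Im w.
Proof. by case: z w => [a b] []. Qed.

Lemma cImM (z w : R[i]) : Im (z * w) = Re z * Im w + Im z * Re w.
Proof. by case: z w => [a b] []. Qed.

Lemma cReD (z w : R[i]) : Re (z + w) = Re z + Re w.
Proof. by case: z w => [a b] []. Qed.

Lemma cImD (z w : R[i]) : Im (z + w) = Im z + Im w.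
Proof. by case: z w => [a b] []. Qed.

Lemma cReJ (z : R[i]) : Re z^* = Re z.
Proof. by case: z. Qed.

Lemma cImJ (z : R[i]) : Im z^* = - Im z.
Proof. by case: z. Qed.

Lemma cReN (z : R[i]) : Re (- z) = - Re z.
Proof. by case: z. Qed.

Lemma cImN (z : R[i]) : Im (- z) = - Im z.
Proof. by case: z. Qed.

Lemma complex_ext (z w : R[i]) : Re z = Re w -> Im z = Im w -> z = w.
Proof. by case: z w => [a b] [c d] /= -> ->. Qed.

Lemma conjD (z w : R[i]) : (z + w)^* = z^* + w^*.
Proof. exact: rmorphD. Qed.

Lemma conjM (z w : R[i]) : (z * w)^* = z^* * w^*.
Proof. exact: rmorphM. Qed.

Lemma conjN (z : R[i]) : (- z)^* = - z^*.
Proof. exact: rmorphN. Qed.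

Lemma conjK (z : R[i]) : z^*^* = z.
Proof. exact: conjCK. Qed.

Lemma cmeasM (u v : R -> R[i]) : cmeas u -> cmeas v ->
  cmeas (fun x => u x * v x).
Proof.
move=> [ru iu] [rv iv]; split.
- rewrite /comp; under eq_fun do rewrite /= cReM.
  by apply: measurable_funB; apply: measurable_funM.
- rewrite /comp; under eq_fun do rewrite /= cImM.
  by apply: measurable_funD; apply: measurable_funM.
Qed.

Lemma cmeasD (u v : R -> R[i]) : cmeas u -> cmeas v ->
  cmeas (fun x => u x + v x).
Proof.
move=> [ru iu] [rv iv]; split.
- rewrite /comp; by under eq_fun do rewrite /= cReD; apply: measurable_funD.
- rewrite /comp; by under eq_fun do rewrite /= cImD; apply: measurable_funD.
Qed.

Lemma cmeas_cst a : cmeas (fun=> a : R[i]).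
Proof. by split; exact: measurable_cst. Qed.

Lemma cmeasJ (u : R -> R[i]) : cmeas u -> cmeas (fun x => (u x)^*).
Proof.
move=> [ru iu]; split.
- rewrite /comp; by under eq_fun do rewrite /= cReJ.
- rewrite /comp; by under eq_fun do rewrite /= cImJ; apply: measurable_funN.
Qed.

Lemma integrable_realD (D : set (measurableTypeR R)) (f g : R -> R) : measurable D ->
  mu.-integrable D (EFin \o f) -> mu.-integrable D (EFin \o g) ->
  mu.-integrable D (EFin \o (fun x => f x + g x)).
Proof. by move=> mD fi gi; exact: (integrableD mD fi gi). Qed.

Lemma integrable_realB (D : set (measurableTypeR R)) (f g : R -> R) : measurable D ->
  mu.-integrable D (EFin \o f) -> mu.-integrable D (EFin \o g) ->
  mu.-integrable D (EFin \o (fun x => f x - g x)).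
Proof. by move=> mD fi gi; exact: (integrableB mD fi gi). Qed.

Lemma integrable_realZ (D : set (measurableTypeR R)) a (f : R -> R) : measurable D ->
  mu.-integrable D (EFin \o f) ->
  mu.-integrable D (EFin \o (fun x => a * f x)).
Proof. by move=> mD fi; exact: (integrableZl mD a fi). Qed.

Definition cintegrable (D : set (measurableTypeR R)) (u : R -> R[i]) :=
  mu.-integrable D (EFin \o (Re \o u)) /\ mu.-integrable D (EFin \o (Im \o u)).

Lemma cintegrable_mulJ (u v : R -> R[i]) :
  u \in @L2pred R -> v \in @L2pred R ->
  cintegrable setT (fun x => u x * (v x)^*).
Proof.
move=> /andP[ru iu] /andP[rv iv]; split; apply/Lfun1_integrable.
- have -> : Re \o (fun x => u x * (v x)^*) =
    ((Re \o u) \* (Re \o v)) \+ ((Im \o u) \* (Im \o v)).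
    by apply/funext => x /=; rewrite cReM cReJ cImJ mulrN opprK.
  by apply: rpredD; apply: Lfun2_mul_Lfun1.
- have -> : Im \o (fun x => u x * (v x)^*) =
    ((Im \o u) \* (Re \o v)) \- ((Re \o u) \* (Im \o v)).
    by apply/funext => x /=; rewrite cImM cReJ cImJ mulrN addrC.
  by apply: rpredB; apply: Lfun2_mul_Lfun1.
Qed.

Lemma cintegral_ae (D : set (measurableTypeR R)) (u v : R -> R[i]) : measurable D ->
  cmeas u -> cmeas v -> {ae mu, forall x, D x -> u x = v x} ->
  cintegral D u = cintegral D v.
Proof.
move=> mD [ru iu] [rv iv] uv; rewrite /cintegral /Rintegral.
congr (fine _ +i* fine _)%C; apply: ae_eq_integral => //.
- by apply/measurable_EFinP; exact: measurable_funTS.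
- by apply/measurable_EFinP; exact: measurable_funTS.
- by apply: ae_imp uv => x /[apply] ->.
- by apply/measurable_EFinP; exact: measurable_funTS.
- by apply/measurable_EFinP; exact: measurable_funTS.
- by apply: ae_imp uv => x /[apply] ->.
Qed.

Lemma cintegralL (D : set (measurableTypeR R)) a (u v : R -> R[i]) : measurable D ->
  cintegrable D u -> cintegrable D v ->
  cintegral D (fun x => a * u x + v x) = a * cintegral D u + cintegral D v.
Proof.
move=> mD [ru iu] [rv iv].
apply: complex_ext; rewrite ?cReD ?cImD ?cReM ?cImM /=.
- under eq_Rintegral do rewrite cReD cReM.
  rewrite RintegralD//; last by apply: integrable_realB => //; exact: integrable_realZ.
  by rewrite RintegralB ?RintegralZl//; exact: integrable_realZ.
- under eq_Rintegral do rewrite cImD cImM.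
  rewrite RintegralD//; last by apply: integrable_realD => //; exact: integrable_realZ.
  by rewrite RintegralD ?RintegralZl//; exact: integrable_realZ.
Qed.

Lemma cintegralJ (D : set (measurableTypeR R)) (u : R -> R[i]) : measurable D ->
  cintegrable D u -> cintegral D (fun x => (u x)^*) = (cintegral D u)^*.
Proof.
move=> mD [ru iu].
apply: complex_ext; rewrite ?cReJ ?cImJ /=.
- by under eq_Rintegral do rewrite cReJ.
- under eq_Rintegral do rewrite cImJ -mulN1r.
  by rewrite RintegralZl// mulN1r.
Qed.

(** Frees inner products from the chosen representatives: any measurable functions equal to them
    almost everywhere will do. *)
Lemma dotE (u v : R -> R[i]) (f g : H) : cmeas u -> cmeas v ->
  {ae mu, forall x, rep f x = u x} -> {ae mu, forall x, rep g x = v x} ->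
  dot f g = cintegral setT (fun x => u x * (v x)^*).
Proof.
move=> mu_ mv fu gv; apply: cintegral_ae => //.
- by apply: cmeasM; [|apply: cmeasJ]; exact: rep_cmeas.
- by apply: cmeasM => //; exact: cmeasJ.
- by move: fu gv; apply: ae_imp2 => x -> ->.
Qed.

Lemma dotL a (f g h : H) : dot (a *: f + g) h = a * dot f h + dot g h.
Proof.
rewrite -cintegralL//; last 2 first.
- by apply: cintegrable_mulJ; exact: rep_in.
- by apply: cintegrable_mulJ; exact: rep_in.
rewrite (@dotE (fun x => a * rep f x + rep g x) (rep h))//.
- by congr cintegral; apply/funext => x; rewrite mulrDl mulrA.
- apply: cmeasD; last exact: rep_cmeas.
  by apply: cmeasM; [exact: cmeas_cst|exact: rep_cmeas].
- exact: rep_cmeas.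
- exact: repL.
- exact: aeW.
Qed.

Lemma dotC (f g : H) : dot g f = (dot f g)^*.
Proof.
rewrite -cintegralJ//; last by apply: cintegrable_mulJ; exact: rep_in.
by congr cintegral; apply/funext => x; rewrite conjM conjK mulrC.
Qed.

Lemma dotDl (f g h : H) : dot (f + g) h = dot f h + dot g h.
Proof. by rewrite -[f]scale1r dotL mul1r scale1r. Qed.

Lemma dot0l (h : H) : dot 0 h = 0.
Proof. by have /eqP := dotDl 0 0 h; rewrite addr0 -subr_eq0 opprD addNKr oppr_eq0 => /eqP. Qed.

Lemma dotZl a (f h : H) : dot (a *: f) h = a * dot f h.
Proof. by rewrite -[a *: f]addr0 dotL dot0l addr0. Qed.

Lemma dotNl (f h : H) : dot (- f) h = - dot f h.
Proof. by rewrite -scaleN1r dotZl mulN1r. Qed.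

Lemma dotBl (f g h : H) : dot (f - g) h = dot f h - dot g h.
Proof. by rewrite dotDl dotNl. Qed.

Lemma dot0r (h : H) : dot h 0 = 0.
Proof. by rewrite dotC dot0l rmorph0. Qed.

Lemma dotDr (f g h : H) : dot h (f + g) = dot h f + dot h g.
Proof. by rewrite dotC dotDl conjD -!dotC. Qed.

Lemma dotZr a (f h : H) : dot h (a *: f) = a^* * dot h f.
Proof. by rewrite dotC dotZl conjM -!dotC. Qed.

Lemma dotNr (f h : H) : dot h (- f) = - dot h f.
Proof. by rewrite dotC dotNl conjN -!dotC. Qed.

Lemma dotBr (f g h : H) : dot h (f - g) = dot h f - dot h g.
Proof. by rewrite dotDr dotNr. Qed.

Lemma dot0C (f g : H) : dot f g = 0 -> dot g f = 0.
Proof. by move=> fg; rewrite dotC fg rmorph0. Qed.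

(** The square of [hnorm]. Being quadratic, it expands by [ring] and avoids square roots. *)
Definition nsq (h : H) : R := Re (dot h h).

Lemma nsqE (h : H) : nsq h = \int[mu]_x sqmod (rep h x).
Proof.
rewrite /nsq /dot /=; apply: eq_Rintegral => x _.
by rewrite cReM cReJ cImJ mulrN opprK -!expr2.
Qed.

Lemma dot_self (h : H) : dot h h = (nsq h)%:C%C.
Proof.
apply: complex_ext => //=; rewrite /dot /=; under eq_Rintegral => x _.
  rewrite cImM cReJ cImJ mulrN mulrC addNr.
  over.
by rewrite Rintegral_cst// mul0r.
Qed.

Lemma nsq_ge0 (h : H) : 0 <= nsq h.
Proof. by rewrite nsqE; apply: Rintegral_ge0 => x _; exact: sqmod_ge0. Qed.

Lemma nsqE_ereal (h : H) : ((nsq h)%:E = \int[mu]_x (sqmod (rep h x))%:E)%E.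
Proof.
rewrite nsqE /Rintegral fineK//; apply: integrable_fin_num => //.
by have /L2predP[] := rep_in h.
Qed.

Lemma nsq_eq0 (h : H) : nsq h = 0 -> h = 0.
Proof.
move=> h0; apply/L2_eqP; have [[mr mi] ih] := (L2predP _).1 (rep_in h).
have msq : measurable_fun (setT : set (measurableTypeR R))
    (EFin \o (sqmod \o rep h)) by case/integrableP: ih.
have [+ _] := ae_eq_integral_abs mu measurableT msq.
move=> /(_ _)[].
  rewrite -[RHS](congr1 EFin h0) nsqE_ereal; apply: eq_integral => x _ /=.
  by rewrite ger0_norm ?sqmod_ge0.
move=> N N0; have : {ae mu, forall x, setT x -> (EFin \o (sqmod \o rep h)) x = 0%E} by exists N.
have := @rep0 R; apply: ae_imp2 => x -> /(_ I) /= [] /eqP.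
by rewrite sqmod_eq0 => /eqP.
Qed.

Lemma nsqD (f g : H) : nsq (f + g) = nsq f + nsq g + 2 * Re (dot f g).
Proof.
rewrite /nsq dotDl !dotDr (dotC f g) !cReD cReJ; ring.
Qed.

Lemma nsqZ a (f : H) : nsq (a *: f) = sqmod a * nsq f.
Proof.
rewrite /nsq dotZl dotZr (dot_self f) !cReM !cImM cReJ cImJ /sqmod /=.
by rewrite -/(nsq f); ring.
Qed.

Lemma nsqN (f : H) : nsq (- f) = nsq f.
Proof. by rewrite /nsq dotNl dotNr opprK. Qed.

Lemma nsqB (f g : H) : nsq (f - g) = nsq f + nsq g - 2 * Re (dot f g).
Proof. by rewrite nsqD nsqN dotNr cReN mulrN. Qed.

Lemma nsq0 : nsq 0 = 0.
Proof. by rewrite /nsq dot0l. Qed.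

Lemma sqmodR (a : R) : sqmod a%:C%C = a ^+ 2.
Proof. by rewrite /sqmod /= expr0n addr0. Qed.

Lemma Re_dotZr (a : R) (f g : H) : Re (dot f (a%:C%C *: g)) = a * Re (dot f g).
Proof. by rewrite dotZr cReM cReJ cImJ /= oppr0 mul0r subr0. Qed.

Lemma hnorm_ge0 (f : H) : 0 <= hnorm f. Proof. exact: sqrtr_ge0. Qed.

Lemma hnorm_sqr (f : H) : hnorm f ^+ 2 = nsq f.
Proof. by rewrite sqr_sqrtr// nsq_ge0. Qed.

Lemma hnorm_eq (f g : H) : nsq f = nsq g -> hnorm f = hnorm g.
Proof. by rewrite /hnorm -!/(nsq _) => ->. Qed.

Lemma hnorm_eq0 (f : H) : hnorm f = 0 -> f = 0.
Proof. by move=> f0; apply: nsq_eq0; rewrite -hnorm_sqr f0 expr0n. Qed.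

Lemma hnorm0 : hnorm (0 : H) = 0.
Proof. by rewrite /hnorm -/(nsq _) nsq0 sqrtr0. Qed.

Lemma hnorm_opp (f : H) : hnorm (- f) = hnorm f.
Proof. exact/hnorm_eq/nsqN. Qed.

Lemma hnorm_subC (f g : H) : hnorm (f - g) = hnorm (g - f).
Proof. by rewrite -hnorm_opp opprB. Qed.

Lemma hnorm_scale a (f : H) : hnorm (a *: f) = Num.sqrt (sqmod a) * hnorm f.
Proof. by rewrite /hnorm -!/(nsq _) nsqZ sqrtrM ?sqmod_ge0. Qed.

(** Cauchy-Schwarz: the vector [|g| f - |f| g] has a nonnegative square norm, which expands to
    [2 |f| |g| (|f| |g| - Re (f, g))]. The degenerate cases come first, to allow the division by
    [|f| |g|]. *)
Lemma Re_dot_le (f g : H) : Re (dot f g) <= hnorm f * hnorm g.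
Proof.
have [g0|gn0] := eqVneq (hnorm g) 0.
  by rewrite (hnorm_eq0 g0) dot0r hnorm0 mulr0.
have gp : 0 < hnorm g by rewrite lt_neqAle eq_sym gn0 hnorm_ge0.
have [f0|fn0] := eqVneq (hnorm f) 0.
  by rewrite (hnorm_eq0 f0) dot0l hnorm0 mul0r.
have fp : 0 < hnorm f by rewrite lt_neqAle eq_sym fn0 hnorm_ge0.
have := nsq_ge0 ((hnorm g)%:C%C *: f - (hnorm f)%:C%C *: g).
rewrite nsqB !nsqZ !sqmodR Re_dotZr dotC cReJ Re_dotZr (dotC f) cReJ -!hnorm_sqr.
move=> h; have : 0 <= (2 * hnorm g * hnorm f) * (hnorm g * hnorm f - Re (dot f g)) by nra.
by rewrite pmulr_rge0 ?mulr_gt0// subr_ge0 mulrC.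
Qed.

Lemma hnorm_leD (f g : H) : hnorm (f + g) <= hnorm f + hnorm g.
Proof.
rewrite -(ler_pXn2r (n := 2))// ?nnegrE ?addr_ge0 ?hnorm_ge0//.
rewrite hnorm_sqr nsqD -!hnorm_sqr; have := Re_dot_le f g; nra.
Qed.

Lemma hnorm_leB (f g : H) : hnorm (f - g) <= hnorm f + hnorm g.
Proof. by rewrite -(hnorm_opp g) hnorm_leD. Qed.

Lemma hnorm_trans (g f h : H) : hnorm (f - h) <= hnorm (f - g) + hnorm (g - h).
Proof. by apply: le_trans (hnorm_leD _ _); rewrite addrA subrK. Qed.

Lemma parallelogram (f g : H) : nsq (f + g) + nsq (f - g) = 2 * nsq f + 2 * nsq g.
Proof. rewrite nsqD nsqB; ring. Qed.

End Dot.

(** * Completeness *)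

Section Complete.
Context {R : realType}.
Local Notation mu := (@lebesgue_measure R).
Local Notation H := (L2 R).
Local Notation Re := (@complex.Re R).
Local Notation Im := (@complex.Im R).

Lemma sqr_le_geometric_cvg (v : nat -> R) C :
  (forall n m, (n <= m)%N -> (v m - v n) ^+ 2 <= C / 2 ^+ n) -> cvgn v.
Proof.
move=> vC; apply/cauchy_cvgP/cauchy_exP => e e0.
have C0 : 0 <= C by have := vC 0%N 0%N (leqnn _); rewrite subrr expr0n divr1.
have /cvgrPdist_lt : geometric C (2^-1) @ \oo --> (0 : R).
  by apply: cvg_geometric; rewrite ger0_norm// invf_lt1// ltr1n.
move=> /(_ (e ^+ 2)); rewrite exprn_gt0// => /(_ isT)[N _ HN].
exists (v N), N => // m /= Nm; rewrite /ball /=.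
have := HN N (leqnn _); rewrite /= sub0r normrN exprVn ger0_norm; last first.
  by rewrite divr_ge0// exprn_ge0.
move=> H1; rewrite -(ltr_pXn2r (n := 2))// ?nnegrE ?(ltW e0)//.
rewrite real_normK ?num_real// -sqrrN opprB.
by apply: le_lt_trans H1; exact: vC.
Qed.

(* Iterating (a + b)^2 <= 2 a^2 + 2 b^2; the weights [2 ^+ k] make the constants
   decay geometrically. *)
Lemma sqr_telescope_le (v : nat -> R) n m : (n <= m)%N ->
  (v m - v n) ^+ 2 <= 2 / 2 ^+ n * \sum_(n <= k < m) 2 ^+ k * (v k.+1 - v k) ^+ 2.
Proof.
move=> /subnKC <-; move: (m - n)%N => k; elim: k n => [n|k IH n].
  by rewrite addn0 subrr expr0n big_geq// mulr0.
rewrite big_ltn; last by rewrite addnS ltnS leq_addr.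
rewrite !addnS.
have := IH n.+1; rewrite addSn; set S := \sum_(n.+1 <= _ < _) _ => h.
have -> : v (n + k).+1 - v n = (v n.+1 - v n) + (v (n + k).+1 - v n.+1).
  by ring.
have p : 0 < 2 ^+ n :> R by rewrite exprn_gt0.
have e : 2 / 2 ^+ n.+1 = (2 ^+ n)^-1 :> R.
  by rewrite (exprS 2 n) invfM mulrA divff// mul1r.
rewrite e in h.
set a := v n.+1 - v n; set b := v _ - v n.+1 in h *.
have -> : 2 / 2 ^+ n * (2 ^+ n * a ^+ 2 + S) = 2 * a ^+ 2 + 2 * ((2 ^+ n)^-1 * S).
  by field; rewrite gt_eqF.
have := sqr_ge0 (a - b); nra.
Qed.

(** The weighted squared increments sum to a function G of integral at most 1, hence finite almost
    everywhere. Telescoping bounds [(v m - v n)^2] by [2 G / 2^n], which gives pointwise convergence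
    and, after integration, the rate in the conclusion. *)
Lemma riesz_fischer_real (v : nat -> R -> R) :
  (forall n, measurable_fun (setT : set (measurableTypeR R)) (v n)) ->
  (forall n, (\int[mu]_x ((2 ^+ n * (v n.+1 x - v n x) ^+ 2)%:E) <=
              (1 / (2 ^ n.+1)%:R)%:E)%E) ->
  exists2 w : R -> R, measurable_fun (setT : set (measurableTypeR R)) w &
    forall n, (\int[mu]_x (((w x - v n x) ^+ 2)%:E) <= (2 / 2 ^+ n)%:E)%E.
Proof.
move=> mv Iv.
pose f (n : nat) (x : measurableTypeR R) := (2 ^+ n * (v n.+1 x - v n x) ^+ 2)%:E.
have f0 n x : (0 <= f n x)%E by rewrite lee_fin mulr_ge0 ?sqr_ge0// exprn_ge0.
have mf n : measurable_fun setT (f n).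
  apply/measurable_EFinP; apply: measurable_funM => //.
  by apply: measurable_funX; apply: measurable_funB.
pose G x := (\sum_(n <oo) f n x)%E.
have G0 x : (0 <= G x)%E by apply: nneseries_ge0.
have mG : measurable_fun setT G.
  by apply: (ge0_emeasurable_sum (P := xpredT)).
have IG : (\int[mu]_x G x <= 1%:E)%E.
  rewrite integral_nneseries//.
  apply: le_trans (epsilon_trick0 xpredT (ler01)).
  by apply: lee_nneseries => n _; rewrite ?integral_ge0//; exact: Iv.
have iG : mu.-integrable setT G.
  apply/integrableP; split=> //; apply: le_lt_trans (ltry 1).
  by under eq_integral do rewrite gee0_abs//.
have Gae := integrable_ae measurableT iG.
pose E := [set x | (G x < +oo)%E].
have mE : measurable E.
  by rewrite -[E]setTI; exact: emeasurable_fun_infty_o.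
(* Cutting off where G is infinite makes the sequence converge at every point, so that its limit is
   measurable without an exceptional set. *)
pose u n x := v n x * \1_E x.
have mu_ n : measurable_fun (setT : set (measurableTypeR R)) (u n).
  by apply: measurable_funM => //; exact: measurable_indic.
have uE n m x : (n <= m)%N -> (u m x - u n x) ^+ 2 <= (2 * fine (G x)) / 2 ^+ n.
  move=> nm; rewrite /u indicE; have [xE|xE] := boolP (x \in E); last first.
    rewrite !mulr0 subrr expr0n divr_ge0// ?exprn_ge0// mulr_ge0// fine_ge0//.
  rewrite !mulr1; apply: le_trans (sqr_telescope_le (v ^~ x) nm) _.
  rewrite mulrAC ler_pM2r ?invr_gt0 ?exprn_gt0// ler_pM2l//.
  move: xE; rewrite inE /E /= => xE.
  rewrite -lee_fin fineK ?ge0_fin_numE// -sumEFin.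
  apply: le_trans (nneseries_lim_ge (P := xpredT) (m := 0) m _); last first.
    by move=> *; exact: f0.
  rewrite [leRHS](big_cat_nat (leq0n n) nm)//= leeDr//.
  by apply: sume_ge0 => k _; exact: f0.
have cu x : cvgn (u ^~ x).
  by apply: (@sqr_le_geometric_cvg _ (2 * fine (G x))) => n m; exact: uE.
pose w x := limn (u ^~ x).
have mw : measurable_fun (setT : set (measurableTypeR R)) w.
  by apply: (measurable_fun_cvg mu_) => x _; exact: cu.
exists w => // n.
have wE x : (w x - u n x) ^+ 2 <= (2 * fine (G x)) / 2 ^+ n.
  have : (u m x - u n x) ^+ 2 @[m --> \oo] --> (w x - u n x) ^+ 2.
    have cw : u m x @[m --> \oo] --> w x := cu x.
    have cB : (u m x - u n x) @[m --> \oo] --> w x - u n x.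
      by apply: cvgB => //; exact: cvg_cst.
    have : (u m x - u n x) * (u m x - u n x) @[m --> \oo] -->
        (w x - u n x) * (w x - u n x) by exact: cvgM.
    by rewrite -expr2; under eq_fun do rewrite -expr2.
  move=> cc; rewrite -(cvg_lim _ cc)//; apply: limr_le; first exact: cvgP cc.
  by exists n => // m /= nm; exact: uE.
apply: (@le_trans _ _ (\int[mu]_x ((2 / 2 ^+ n)%:E * G x))%E).
  apply: ae_ge0_le_integral => //.
  - by move=> x _; rewrite lee_fin sqr_ge0.
  - by apply/measurable_EFinP; apply: measurable_funX; apply: measurable_funB.
  - by move=> x _; rewrite mule_ge0// lee_fin divr_ge0// exprn_ge0.
  - by apply: measurable_funeM.
  - apply: ae_imp Gae => x /(_ I) Gx _.
    have xE : x \in E by rewrite inE /E /= -ge0_fin_numE.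
    have := wE x; rewrite /u indicE xE mulr1 => h.
    by rewrite -(fineK Gx) -EFinM lee_fin mulrAC.
have c0 : (0 <= (2 / 2 ^+ n : R)%:E)%E by rewrite lee_fin divr_ge0// exprn_ge0.
rewrite ge0_integralZl//.
by rewrite -[leRHS]mule1; apply: lee_wpmul2l.
Qed.

Definition hcauchy (u : nat -> H) := forall e, 0 < e ->
  exists N, forall m n, (N <= m)%N -> (N <= n)%N -> hnorm (u m - u n) < e.

Definition hcvg (u : nat -> H) (l : H) := forall e, 0 < e ->
  exists N, forall n, (N <= n)%N -> hnorm (u n - l) < e.

Lemma nsq_ae (h : H) (u : R -> R[i]) : cmeas u ->
  {ae mu, forall x, rep h x = u x} ->
  ((nsq h)%:E = \int[mu]_x (sqmod (u x))%:E)%E.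
Proof.
move=> [ru iu] hu; rewrite nsqE_ereal; have [rh ih] := rep_cmeas h.
apply: ae_eq_integral => //.
- by apply/measurable_EFinP; apply: measurable_funD; apply: measurable_funX.
- by apply/measurable_EFinP; apply: measurable_funD; apply: measurable_funX.
- by apply: ae_imp hu => x -> _.
Qed.

Lemma L2predL a (u v : R -> R[i]) : u \in @L2pred R -> v \in @L2pred R ->
  (fun x => a * u x + v x) \in @L2pred R.
Proof. by have [_] := L2pred_submod_closed R; apply. Qed.

Lemma hcauchy_fast (u : nat -> H) (e : nat -> R) : hcauchy u ->
  (forall n, 0 < e n) -> exists2 phi : nat -> nat, (forall n, n <= phi n)%N &
  forall n m, (phi n <= m)%N -> hnorm (u m - u (phi n)) < e n /\ hnorm (u (phi n.+1) - u (phi n)) < e n.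
Proof.
move=> cu e0; have /choice[N HN] n := cu (e n) (e0 n).
(* The partial sums of [N i + 1] increase, dominate [N n], and are at least n. *)
pose phi n := (\sum_(i < n.+1) (N i).+1)%N.
have phiN n : (N n <= phi n)%N by rewrite /phi big_ord_recr /= ltnW// leq_addl.
have phiS n : (phi n <= phi n.+1)%N by rewrite /phi [leqRHS]big_ord_recr /= leq_addr.
exists phi => [n|n m nm].
  rewrite /phi -[leqLHS](card_ord n) -sum1_card big_ord_recr /=.
  by apply: leq_trans (leq_addr _ _); apply: leq_sum.
split; apply: HN => //.
- exact: leq_trans nm.
- exact: leq_trans (phiS _).
Qed.

Lemma L2_complete (u : nat -> H) : hcauchy u -> exists l, hcvg u l.
Proof.
(* Chosen so that [2^n e_n^2 = 1 / 2^(n+1)], the bound required by [riesz_fischer_real]. *)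
move=> cu; pose e n : R := Num.sqrt (1 / (2 ^ n.+1)%:R / 2 ^+ n).
have e0 n : 0 < e n.
  by rewrite sqrtr_gt0 !divr_gt0 ?exprn_gt0// ltr0n expn_gt0.
have [phi phin phiP] := hcauchy_fast cu e0.
pose v n := rep (u (phi n)).
have v_meas n : cmeas (v n) by exact: rep_cmeas.
have vE n : ((\int[mu]_x (2 ^+ n * (sqmod (v n.+1 x - v n x)))%:E) <=
              (1 / (2 ^ n.+1)%:R)%:E)%E.
  have mB : cmeas (fun x => v n.+1 x - v n x).
    have := cmeasD (v_meas n.+1) (cmeasM (cmeas_cst (-1)) (v_meas n)).
    by under eq_fun do rewrite mulN1r.
  under eq_integral do rewrite EFinM.
  have mB' : measurable_fun (setT : set (measurableTypeR R))
      (fun x => (sqmod (v n.+1 x - v n x))%:E).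
    apply/measurable_EFinP; case: mB => m1 m2.
    by apply: measurable_funD; apply: measurable_funX.
  rewrite ge0_integralZl ?lee_fin ?exprn_ge0//; last first.
    by move=> x _; rewrite lee_fin sqmod_ge0.
  rewrite -(nsq_ae (h := u (phi n.+1) - u (phi n)) mB); last exact: repB.
  rewrite -EFinM lee_fin mulrC -ler_pdivlMr ?exprn_gt0// -hnorm_sqr.
  have [_ /ltW h] := phiP n _ (leqnn _).
  apply: le_trans (_ : e n ^+ 2 <= _); last first.
    by rewrite sqr_sqrtr// !divr_ge0// exprn_ge0.
  by rewrite ler_pXn2r// nnegrE ?hnorm_ge0// ltW.
(* p stands for the real or the imaginary part; both are additive with square at most [sqmod]. *)
have part (p : R[i] -> R) :
    (forall n, measurable_fun (setT : set (measurableTypeR R)) (p \o v n)) ->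
    (forall z w, p (z - w) = p z - p w) -> (forall z, p z ^+ 2 <= sqmod z) ->
    exists2 w : R -> R, measurable_fun (setT : set (measurableTypeR R)) w &
    forall n, (\int[mu]_x (((w x - p (v n x)) ^+ 2)%:E) <= (2 / 2 ^+ n)%:E)%E.
  move=> mp pB ple.
  apply: (@riesz_fischer_real (fun n => p \o v n)) => // n.
  apply: le_trans (vE n); apply: ge0_le_integral => //.
  - by move=> x _; rewrite lee_fin mulr_ge0 ?sqr_ge0// exprn_ge0.
  - apply/measurable_EFinP; apply: measurable_funM => //; apply: measurable_funX.
    exact: measurable_funB.
  - apply/measurable_EFinP; apply: measurable_funM => //.
    have := cmeasD (v_meas n.+1) (cmeasM (cmeas_cst (-1)) (v_meas n)).
    under eq_fun do rewrite mulN1r.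
    by move=> [m1 m2]; apply: measurable_funD; apply: measurable_funX.
  - by move=> x _; rewrite lee_fin ler_pM2l ?exprn_gt0//= -pB.
have [|||wr mwr Hr] := part Re.
- by move=> n; have [] := v_meas n.
- by move=> z w; rewrite cReD cReN.
- by move=> z; rewrite lerDl sqr_ge0.
have [|||wi mwi Hi] := part Im.
- by move=> n; have [] := v_meas n.
- by move=> z w; rewrite cImD cImN.
- by move=> z; rewrite lerDr sqr_ge0.
pose w x := (wr x +i* wi x)%C.
have mw : cmeas w by split.
have mB n : cmeas (fun x => w x - v n x).
  have := cmeasD mw (cmeasM (cmeas_cst (-1)) (v_meas n)).
  by under eq_fun do rewrite mulN1r.
have wE n : (\int[mu]_x (sqmod (w x - v n x))%:E <= (4 / 2 ^+ n)%:E)%E.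
  have -> : 4 / 2 ^+ n = 2 / 2 ^+ n + 2 / 2 ^+ n :> R by rewrite -mulrDl -natrD.
  rewrite EFinD; apply: le_trans (leeD (Hr n) (Hi n)).
  have [m1 m2] := v_meas n.
  rewrite -ge0_integralD//.
  - rewrite le_eqVlt; apply/orP; left; apply/eqP; apply: eq_integral => x _.
    by rewrite -EFinD /sqmod cReD cReN cImD cImN.
  - by move=> x _; rewrite lee_fin sqr_ge0.
  - by apply/measurable_EFinP; apply: measurable_funX; apply: measurable_funB.
  - by move=> x _; rewrite lee_fin sqr_ge0.
  - by apply/measurable_EFinP; apply: measurable_funX; apply: measurable_funB.
(* The estimate only says that [w - v 0] is square integrable; adding [v 0] back gives w. *)
have wL : w \in @L2pred R.
  have : (fun x => w x - v 0%N x) \in @L2pred R.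
    apply/L2predP; split; first exact: mB.
    apply/integrableP; split.
      apply/measurable_EFinP; have [m1 m2] := mB 0%N.
      by apply: measurable_funD; apply: measurable_funX.
    apply: le_lt_trans (ltry (4 / 2 ^+ 0)); apply: le_trans (wE 0%N).
    by under eq_integral do rewrite /= ger0_norm ?sqmod_ge0//.
  move=> wB; have := L2predL 1 wB (rep_in (u (phi 0%N))).
  suff -> : (fun x => 1 * (w x - v 0%N x) + rep (u (phi 0%N)) x) = w by [].
  by apply/funext => x; rewrite mul1r subrK.
exists (toL2 w) => d d0.
have d2 : 0 < d / 2 by rewrite divr_gt0.
have [N HN] := cu (d / 2) d2.
have /cvgrPdist_lt : geometric (4 : R) (2^-1) @ \oo --> (0 : R).
  by apply: cvg_geometric; rewrite ger0_norm// invf_lt1// ltr1n.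
move=> /(_ ((d / 2) ^+ 2)); rewrite exprn_gt0// => /(_ isT)[K _ HK].
have HK' n : (K <= n)%N -> hnorm (u (phi n) - toL2 w) < d / 2.
  move=> Kn; have := HK n Kn; rewrite /= sub0r normrN exprVn ger0_norm; last first.
    by rewrite divr_ge0// exprn_ge0.
  move=> h; rewrite -(ltr_pXn2r (n := 2)) ?nnegrE ?hnorm_ge0 ?(ltW d2)//.
  apply: le_lt_trans h; rewrite hnorm_sqr -nsqN opprB -lee_fin.
  rewrite (nsq_ae (mB n)); first exact: wE.
  have := repB (toL2 w) (u (phi n)); have := rep_toL2 wL.
  by apply: ae_imp2 => x <- ->.
exists N => n Nn.
pose k := maxn K n.
rewrite (splitr d); apply: le_lt_trans (hnorm_trans (u (phi k)) _ _) _.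
apply: ltrD; last by apply: HK'; exact: leq_maxl.
by apply: HN => //; apply: leq_trans (phin _); apply: leq_trans Nn _; exact: leq_maxr.
Qed.

End Complete.

(** * Orthogonal projections *)

Section Projection.
Context {R : realType}.
Local Notation H := (L2 R).
Local Notation Re := (@complex.Re R).
Local Notation Im := (@complex.Im R).
Implicit Types (K L : set H) (f g h k : H).

Lemma subBB (V : zmodType) (a b c : V) : (a - b) - (a - c) = c - b.
Proof. by rewrite opprB addrC addrA subrK. Qed.

Section Subspace.
Variable K : set H.
Hypothesis cK : closed_subspace K.

Lemma csub0 : K 0. Proof. by case: cK. Qed.

Lemma csubL a f g : K f -> K g -> K (a *: f + g).
Proof. by case: cK => _ + _; apply. Qed.

Lemma csubD f g : K f -> K g -> K (f + g).
Proof. by move=> Kf Kg; rewrite -[f]scale1r; exact: csubL. Qed.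

Lemma csubZ a f : K f -> K (a *: f).
Proof. by move=> Kf; rewrite -[_ *: f]addr0; apply: csubL => //; exact: csub0. Qed.

Lemma csubN f : K f -> K (- f).
Proof. by move=> Kf; rewrite -scaleN1r; exact: csubZ. Qed.

Lemma csubB f g : K f -> K g -> K (f - g).
Proof. by move=> Kf Kg; apply: csubD => //; exact: csubN. Qed.

Lemma csub_cvg (u : nat -> H) l : (forall n, K (u n)) -> hcvg u l -> K l.
Proof.
move=> Ku ul; case: cK => _ _; apply => e /ul[N HN].
by exists (u N) => //; rewrite hnorm_subC; exact: HN.
Qed.

Lemma is_proj_uniq h k k' : is_proj K h k -> is_proj K h k' -> k = k'.
Proof.
move=> [Kk hk] [Kk' hk']; apply/eqP; rewrite -subr_eq0; apply/eqP/nsq_eq0.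
have Kd : K (k - k') by exact: csubB.
rewrite /nsq; rewrite -(subBB h k' k).
rewrite {1}dotBl; have := hk _ Kd; have := hk' _ Kd.
rewrite subBB.
by move=> -> ->; rewrite subrr.
Qed.

Lemma orth_projE h k : is_proj K h k -> orth_proj K h = k.
Proof.
by move=> hk; apply: (is_proj_uniq _ hk); rewrite /orth_proj; case: xgetP => [_ -> //|/(_ _ hk)].
Qed.

(** The imaginary part of [dot f g] is the real part of [dot f (i g)]. *)
Lemma dot_orth f : (forall g, K g -> Re (dot f g) = 0) -> forall g, K g -> dot f g = 0.
Proof.
move=> f0 g Kg; apply: complex_ext; first exact: f0.
have := f0 _ (csubZ 'i%C Kg); rewrite dotZr cReM cReJ cImJ /=.
by rewrite mul0r sub0r mulN1r opprK.
Qed.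

Lemma proj_exists h : exists k, is_proj K h k.
Proof.
pose D := [set nsq (h - k) | k in K].
have Dinf : has_inf D.
  split; first by exists (nsq (h - 0)), 0 => //; exact: csub0.
  by exists 0 => _ [k _ <-]; exact: nsq_ge0.
pose d := inf D.
have dle k : K k -> d <= nsq (h - k).
  by move=> Kk; apply: ge_inf; [case: Dinf|exists k].
have d0 : 0 <= d by apply: lb_le_inf; [case: Dinf|move=> _ [k _ <-]; exact: nsq_ge0].
have /choice[u uP] n : exists k, K k /\ nsq (h - k) < d + n.+1%:R^-1.
  have n0 : 0 < n.+1%:R^-1 :> R by rewrite invr_gt0.
  by have [_ [k Kk <-] hk] := inf_adherent n0 Dinf; exists k.
have um n m : nsq (u n - u m) <= 2 * n.+1%:R^-1 + 2 * m.+1%:R^-1.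
  have [Kn hn] := uP n; have [Km hm] := uP m.
  have := parallelogram (h - u n) (h - u m).
  rewrite subBB.
  (* The midpoint of [u n] and [u m] lies in K, so its square distance to h is at least d. The
     parallelogram law then makes a minimizing sequence Cauchy. *)
  have -> : h - u n + (h - u m) = 2%:C%C *: (h - 2^-1%:C%C *: (u n + u m)).
    rewrite scalerBr scalerA -rmorphM /= divff// rmorph1 scale1r opprD.
    by rewrite rmorphMn rmorph1 scaler_nat mulr2n addrACA.
  rewrite nsqZ sqmodR -[nsq (u n - u m)]nsqN opprB.
  move: (dle _ (csubZ 2^-1%:C%C (csubD Kn Km))) hn hm.
  move: (n.+1%:R^-1) (m.+1%:R^-1) (nsq (h - u n)) (nsq (h - u m)) (nsq (u m - u n)).
  by move: (nsq (h - _)) => q x y a b c; lra.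
have u_cauchy : hcauchy u.
  move=> e e0; have e4 : 0 < e ^+ 2 / 4 by rewrite divr_gt0 ?exprn_gt0.
  have [N HN] : exists N, forall n, (N <= n)%N -> n.+1%:R^-1 < e ^+ 2 / 4.
    have [N _ HN] := near_infty_natSinv_lt (PosNum e4).
    by exists N => n Nn; exact: HN.
  exists N => m n Nm Nn; rewrite -(ltr_pXn2r (n := 2)) ?nnegrE ?hnorm_ge0 ?(ltW e0)//.
  rewrite hnorm_sqr; apply: le_lt_trans (um _ _) _.
  have := HN _ Nm; have := HN _ Nn; move: (n.+1%:R^-1) (m.+1%:R^-1) (e ^+ 2) => x y z; lra.
have [k uk] := L2_complete u_cauchy.
have Kk : K k by apply: csub_cvg uk => n; have [] := uP n.
have hk : nsq (h - k) <= d.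
  suff : hnorm (h - k) <= Num.sqrt d.
    by rewrite -(ler_pXn2r (n := 2)) ?nnegrE ?hnorm_ge0 ?sqrtr_ge0// hnorm_sqr sqr_sqrtr.
  apply/ler_addgt0Pr => e e0.
  have e2 : 0 < e / 2 by rewrite divr_gt0.
  have [N HN] := uk _ e2.
  have e4 : 0 < (e / 2) ^+ 2 by rewrite exprn_gt0.
  have [N' _ HN'] := near_infty_natSinv_lt (PosNum e4).
  pose n := maxn N N'.
  apply: le_trans (hnorm_trans (u n) _ _) _.
  rewrite (splitr e) addrA lerD//; last exact/ltW/HN/leq_maxl.
  rewrite -(ler_pXn2r (n := 2)) ?nnegrE ?hnorm_ge0 ?addr_ge0 ?sqrtr_ge0 ?(ltW e2)//.
  rewrite hnorm_sqr; have [_ /ltW h1] := uP n; apply: le_trans h1 _.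
  have /= := HN' n (leq_maxr _ _) => h2.
  rewrite sqrrD sqr_sqrtr// -addrA lerD2l.
  rewrite (le_trans (ltW h2))// lerDr mulrn_wge0// mulr_ge0 ?sqrtr_ge0 ?(ltW e2)//.
exists k; split => //; apply: dot_orth => g Kg.
set r := Re _; apply/eqP; rewrite -sqrf_eq0; apply/eqP.
have [g0|gn0] := eqVneq (nsq g) 0.
  by rewrite /r (nsq_eq0 g0) dot0r expr0n.
have gp : 0 < nsq g by rewrite lt_neqAle eq_sym gn0 nsq_ge0.
(* The coefficient [r / nsq g] minimizes the square distance along the line k + c g. The gain is
   [r^2 / nsq g], and minimality of k forces it to be nonpositive. *)
have := dle _ (csubD Kk (csubZ (r / nsq g)%:C%C Kg)).
rewrite opprD addrA nsqB nsqZ sqmodR Re_dotZr -/r => h1.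
have h2 : 0 <= (r / nsq g) ^+ 2 * nsq g - 2 * (r / nsq g * r) by lra.
have : (r / nsq g) ^+ 2 * nsq g - 2 * (r / nsq g * r) = - (r ^+ 2 / nsq g).
  by field.
move=> h3; move: h2; rewrite h3 oppr_ge0 pmulr_lle0 ?invr_gt0// => h4.
by apply/eqP; rewrite eq_le h4 sqr_ge0.
Qed.

Lemma orth_projP h : is_proj K h (orth_proj K h).
Proof. by have [k hk] := proj_exists h; rewrite (orth_projE hk). Qed.

End Subspace.

(** The residue of f after projection onto K is orthogonal to A, hence zero. With [vanishing_csub]
    this reduces limit statements to the vectors of A. *)
Lemma csub_total K (A : set H) : closed_subspace K -> A `<=` K ->
  (forall f, (forall g, A g -> dot f g = 0) -> f = 0) -> forall f, K f.
Proof.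
move=> cK AK At f; have [Kp pP] := orth_projP cK f.
have /eqP := At _ (fun g Ag => pP g (AK _ Ag)).
by rewrite subr_eq0 => /eqP ->.
Qed.

End Projection.

(** * Indicators of intervals are total *)

Section Intervals.
Context {R : realType}.
Local Notation mu := (@lebesgue_measure R).
Local Notation H := (L2 R).
Local Notation Re := (@complex.Re R).
Local Notation Im := (@complex.Im R).

(** By Lebesgue differentiation f is almost everywhere the derivative of its primitive, here the
    zero function. *)
Lemma ae0_itv_integrable (f : R -> R) : mu.-integrable setT (EFin \o f) ->
  (forall y, \int[mu]_(x in `]-oo, y]) f x = 0) -> {ae mu, forall x, f x = 0}.
Proof.
move=> fi f0.
have fi' y : mu.-integrable `]-oo, y] (EFin \o f).
  by apply: integrableS fi => //; exact: measurable_itv.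
have := FTC1Ny fi' (open_integrable_locally openT fi).
apply: ae_imp => x [_].
have -> : (fun y => \int[mu]_(t in `]-oo, y]) f t) = cst 0 by apply/funext => y.
by rewrite derive1_cst.
Qed.

(** A square integrable function need not be integrable on the line, so f is truncated to []-n, n]]
    and the countably many null sets are united. *)
Lemma ae0_itv (f : R -> R) :
  (forall a b, mu.-integrable `]a, b] (EFin \o f)) ->
  (forall a b, \int[mu]_(x in `]a, b]) f x = 0) -> {ae mu, forall x, f x = 0}.
Proof.
move=> fi f0; pose I (n : nat) : set (measurableTypeR R) := `](- n%:R), n%:R]%classic.
have mI n : measurable (I n) by exact: measurable_itv.
have H n : {ae mu, forall x, (f \_ (I n)) x = 0}.
  apply: ae0_itv_integrable.
    by rewrite -restrict_EFin; apply/(integrable_mkcond _ (mI n)).1; exact: fi.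
  move=> y; rewrite -Rintegral_mkcondr.
  have -> : `]-oo, y] `&` I n = `](- n%:R), (Num.min y n%:R)]%classic.
    apply/seteqP; split => x /=; rewrite /I /= !in_itv /= le_min.
    - by move=> [-> /andP[-> ->]].
    - by move=> /andP[-> /andP[-> ->]].
  exact: f0.
have := ae_foralln H; apply: ae_imp => x Hx.
have := Hx (Num.bound `|x|); rewrite patchE mem_set//.
rewrite /I /= in_itv /=; have h := archi_boundP (normr_ge0 x).
have := ler_norm x; have := ler_norm (- x); rewrite normrN => h1 h2.
by apply/andP; split; lra.
Qed.

Definition cindic (a b : R) : H := toL2 (fun x => (\1_(`]a, b]%classic) x)%:C%C).

Lemma cindic_in (D : set (measurableTypeR R)) : measurable D ->
  (mu D < +oo)%E -> (fun x => (\1_D x)%:C%C) \in @L2pred R.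
Proof.
move=> mD Dfin; apply/L2predP; split.
  by split; [exact: measurable_indic|exact: measurable_cst].
have i1 : mu.-integrable setT (fun x => (\1_D x)%:E).
  apply/integrableP; split; first by apply/measurable_EFinP; exact: measurable_indic.
  under eq_integral do rewrite /= ger0_norm//.
  by rewrite integral_indic// setIT.
apply: eq_integrable i1 => // x _.
by rewrite /= sqmodR indicE; case: (_ \in _); rewrite ?expr1n ?expr0n.
Qed.

Lemma cindic_itv_in a b : (fun x => (\1_(`]a, b]%classic) x)%:C%C) \in @L2pred R.
Proof.
apply: cindic_in; first exact: measurable_itv.
by rewrite /= lebesgue_measure_itv /=; case: ifPn => _; rewrite -?EFinD ltry.
Qed.

Lemma dot_cindic (h : H) a b : dot h (cindic a b) = cintegral `]a, b] (rep h).
Proof.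
have /L2predP[mi _] := cindic_itv_in a b.
have hh : {ae mu, forall x, rep h x = rep h x} by exact: aeW.
rewrite (dotE (rep_cmeas h) mi hh (rep_toL2 (cindic_itv_in a b))).
rewrite /cintegral; congr (_ +i* _)%C; rewrite [RHS]Rintegral_mkcond;
  apply: eq_Rintegral => x _; rewrite patchE indicE ?cReM ?cImM cReJ cImJ /=;
  by case: ifPn => _ /=; rewrite ?(mulrN, mulr0, mulr1, oppr0, subr0, addr0, add0r).
Qed.

Lemma cintegrable_mkcond (D : set (measurableTypeR R)) (u : R -> R[i]) :
  measurable D -> cintegrable D u <-> cintegrable setT (fun x => u x * (\1_D x)%:C%C).
Proof.
move=> mD; have E (p : R[i] -> R) :
    (forall z (b : bool), p (z * b%:R%:C%C) = p z * b%:R) ->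
    mu.-integrable D (EFin \o (p \o u)) <->
    mu.-integrable setT (EFin \o (p \o (fun x => u x * (\1_D x)%:C%C))).
  move=> pb; rewrite integrable_mkcond// restrict_EFin.
  suff -> : (p \o u) \_ D = p \o (fun x => u x * (\1_D x)%:C%C) by [].
  apply/funext => x; rewrite /= patchE indicE pb.
  by case: ifPn; rewrite ?mulr1 ?mulr0.
by rewrite /cintegrable !E// => z b; rewrite ?cReM ?cImM /= mulr0 ?subr0 ?add0r.
Qed.

Lemma itv_integrable (h : H) a b : cintegrable `]a, b] (rep h).
Proof.
apply/cintegrable_mkcond; first exact: measurable_itv.
have := cintegrable_mulJ (rep_in h) (cindic_itv_in a b).
congr cintegrable; apply/funext => x; congr (_ * _); apply: complex_ext; rewrite ?cReJ ?cImJ//=.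
by rewrite oppr0.
Qed.

Lemma cindic_total (h : H) : (forall a b, dot h (cindic a b) = 0) -> h = 0.
Proof.
move=> h0; apply/L2_eqP.
have rh : {ae mu, forall x, Re (rep h x) = 0}.
  apply: ae0_itv => a b; first by have [] := itv_integrable h a b.
  by have := h0 a b; rewrite dot_cindic => -[].
have ih : {ae mu, forall x, Im (rep h x) = 0}.
  apply: ae0_itv => a b; first by have [] := itv_integrable h a b.
  by have := h0 a b; rewrite dot_cindic => -[].
have := @rep0 R; move: rh ih; apply: ae_imp3 => x r0 i0 ->; exact: complex_ext.
Qed.
End Intervals.

(** * Multiplication by indicators *)

Section Vanishing.
Context {R : realType}.
Local Notation H := (L2 R).

(** The operators [A s] have a common bound, so the property that [A s h] tends to 0 along F passes
    to limits in h. *)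
Lemma vanishing_csub (T : Type) (F : set_system T) (A : T -> H -> H) (C : R) :
  Filter F ->
  (forall s a f g, A s (a *: f + g) = a *: A s f + A s g) ->
  (forall s h, hnorm (A s h) <= C * hnorm h) ->
  closed_subspace [set h | forall e : R, 0 < e -> \forall s \near F, hnorm (A s h) < e].
Proof.
move=> FF lA bA.
(* No sign is assumed on C; the larger constant [|C| + 1] can be divided by. *)
have C1 : 0 < `|C| + 1 by rewrite ltr_wpDl.
have bA' s h : hnorm (A s h) <= (`|C| + 1) * hnorm h.
  apply: le_trans (bA s h) _; rewrite ler_wpM2r ?hnorm_ge0//.
  by rewrite (le_trans (ler_norm C))// lerDl.
split=> [e e0|a f g fv gv e e0|h hv e e0].
- apply: nearW => s; have := bA s 0; rewrite hnorm0 mulr0 => h0.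
  exact: le_lt_trans h0 e0.
- pose c := Num.sqrt (sqmod a) + 1.
  have c0 : 0 < c by rewrite ltr_wpDl ?sqrtr_ge0.
  have e1 : 0 < e / 2 / c by rewrite !divr_gt0.
  have e2 : 0 < e / 2 by rewrite divr_gt0.
  near=> s; rewrite lA (splitr e).
  refine (le_lt_trans (hnorm_leD _ _) _). apply: ltrD; last by near: s; exact: gv.
  rewrite hnorm_scale.
  have h1 : hnorm (A s f) < e / 2 / c by near: s; exact: fv.
  apply: (@le_lt_trans _ _ (c * hnorm (A s f))).
    by rewrite ler_wpM2r ?hnorm_ge0// lerDl.
  by rewrite mulrC -ltr_pdivlMr.
- have e1 : 0 < e / 2 / (`|C| + 1) by rewrite !divr_gt0.
  have e2 : 0 < e / 2 by rewrite divr_gt0.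
  have [k kv hk] := hv _ e1.
  near=> s.
  have -> : h = 1 *: (h - k) + k by rewrite scale1r subrK.
  rewrite lA scale1r (splitr e).
  apply: le_lt_trans (hnorm_leD _ _) _; apply: ltrD; last by near: s; exact: kv.
  by apply: le_lt_trans (bA' _ _) _; rewrite mulrC -ltr_pdivlMr.
Unshelve. all: by end_near. Qed.

(** Polarization: norms of sums determine the real part of the inner product, and replacing g by i g
    the imaginary part. *)
Lemma isometry_on_dot (K : set H) (A : H -> H) : closed_subspace K ->
  isometry_on K A -> forall f g, K f -> K g -> dot (A f) (A g) = dot f g.
Proof.
move=> cK [AK lA nA].
have nsqA h : K h -> nsq (A h) = nsq h by move=> Kh; rewrite -!hnorm_sqr nA.
have ReE f g : K f -> K g -> complex.Re (dot (A f) (A g)) = complex.Re (dot f g).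
  move=> Kf Kg; have := nsqA _ (csubL cK 1 Kf Kg).
  rewrite lA// !scale1r !nsqD !nsqA// => /addrI /mulfI; apply.
  by rewrite pnatr_eq0.
move=> f g Kf Kg; apply: complex_ext; first exact: ReE.
have := ReE _ _ Kf (csubZ cK 'i%C Kg).
have -> : A ('i%C *: g) = 'i%C *: A g.
  have A0 : A 0 = 0.
    by apply: hnorm_eq0; rewrite nA ?hnorm0//; exact: csub0.
  by rewrite -[_ *: g]addr0 lA ?A0 ?addr0//; exact: csub0.
by rewrite !dotZr !cReM cReJ cImJ /= !mul0r !sub0r !mulN1r !opprK.
Qed.

End Vanishing.

(** * Restriction to a measurable set as an orthogonal projection *)

Section Cut.
Context {R : realType}.
Local Notation mu := (@lebesgue_measure R).
Local Notation H := (L2 R).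
Implicit Types (f g h k : H) (D E : set (measurableTypeR R)).

(** The projection onto [supported D], by [orth_proj_supp], in a form that computes pointwise. *)
Definition L2cut D h : H := toL2 (fun x => if x \in D then rep h x else 0).

Lemma cut_in D h : measurable D ->
  (fun x => if x \in D then rep h x else 0) \in @L2pred R.
Proof.
move=> mD; have E0 : (fun x => if x \in D then rep h x else 0) =
    (fun x => (\1_D x)%:C%C * rep h x).
  by apply/funext => x; rewrite indicE; case: ifPn => _; rewrite ?mul1r ?mul0r.
have mc : cmeas (fun x => if x \in D then rep h x else 0).
  rewrite E0; apply: cmeasM; last exact: rep_cmeas.
  by split; [exact: measurable_indic|exact: measurable_cst].
have /L2predP[_ ih] := rep_in h.
apply/L2predP; split => //; apply: le_integrable ih => //.
  by case: mc => m1 m2; apply/measurable_EFinP; apply: measurable_funD; apply: measurable_funX.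
move=> x _ /=; rewrite lee_fin !ger0_norm ?sqmod_ge0//.
by case: ifPn => // _; rewrite /sqmod /= expr0n addr0 addr_ge0 ?sqr_ge0.
Qed.

Lemma rep_cut D h : measurable D ->
  {ae mu, forall x, rep (L2cut D h) x = if x \in D then rep h x else 0}.
Proof. by move=> mD; exact: rep_toL2 (cut_in h mD). Qed.

Lemma nsq_le f g : {ae mu, forall x, sqmod (rep f x) <= sqmod (rep g x)} -> nsq f <= nsq g.
Proof.
move=> fg; rewrite -lee_fin !nsqE_ereal.
have m h : measurable_fun (setT : set (measurableTypeR R)) (fun x => (sqmod (rep h x))%:E).
  have [m1 m2] := rep_cmeas h.
  by apply/measurable_EFinP; apply: measurable_funD; apply: measurable_funX.
apply: ae_ge0_le_integral => //.
- by move=> x _; rewrite lee_fin sqmod_ge0.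
- by move=> x _; rewrite lee_fin sqmod_ge0.
- by apply: ae_imp fg => x; rewrite lee_fin.
Qed.

Lemma hnorm_le f g : nsq f <= nsq g -> hnorm f <= hnorm g.
Proof. exact: ler_wsqrtr. Qed.

Lemma cut_le D h : measurable D -> hnorm (L2cut D h) <= hnorm h.
Proof.
move=> mD; apply/hnorm_le/nsq_le; apply: ae_imp (rep_cut h mD) => x ->.
by case: ifPn => // _; rewrite /sqmod /= expr0n addr0 addr_ge0 ?sqr_ge0.
Qed.

Lemma cutL D a f g : measurable D -> L2cut D (a *: f + g) = a *: L2cut D f + L2cut D g.
Proof.
move=> mD; apply/L2_eqP.
have e1 := repL a (L2cut D f) (L2cut D g); have e2 := repL a f g.
have e3 := ae_imp2 (fun x => @conj _ _) (rep_cut f mD) (rep_cut g mD).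
apply: ae_imp4 e1 e2 e3 (rep_cut (a *: f + g) mD) => x -> e [-> ->] ->.
by case: ifPn => // _; rewrite mulr0 addr0.
Qed.

Lemma cutB D f g : measurable D -> L2cut D (f - g) = L2cut D f - L2cut D g.
Proof.
by move=> mD; rewrite addrC -scaleN1r cutL// scaleN1r addrC.
Qed.

Lemma dot_ae0 f g : {ae mu, forall x, rep f x * (rep g x)^* = 0} -> dot f g = 0.
Proof.
move=> fg; rewrite /dot (cintegral_ae _ (v := fun=> 0))//.
- by apply: complex_ext; rewrite /= Rintegral_cst ?mul0r.
- by apply: cmeasM; [|apply: cmeasJ]; exact: rep_cmeas.
- exact: cmeas_cst.
- by apply: ae_imp fg => x ->.
Qed.

Lemma cut_supported D h : measurable D -> supported D (L2cut D h).
Proof.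
by move=> mD; apply: ae_imp (rep_cut h mD) => x -> Dx; rewrite memNset.
Qed.

Lemma cut_id D h : measurable D -> supported D h -> L2cut D h = h.
Proof.
move=> mD Dh; apply/L2_eqP; apply: ae_imp2 (rep_cut h mD) Dh => x -> Dx.
by case: ifPn => // /negP; rewrite inE => /Dx ->.
Qed.

Lemma supported_csub D : measurable D -> closed_subspace (supported D).
Proof.
move=> mD; split=> [|a f g fD gD|h hD].
- by rewrite /supported /=; apply: ae_imp (@rep0 R) => x ->.
- rewrite /supported /=; by apply: ae_imp3 (repL a f g) fD gD => x -> + + Dx => -> // ->//; rewrite mulr0 addr0.
(* The cut is a contraction fixing the k that approximate h, so it moves h by less than any positive
   e. *)
- suff <- : L2cut D h = h by exact: cut_supported.
  apply/eqP; rewrite -subr_eq0; apply/eqP/hnorm_eq0/eqP.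
  rewrite eq_le hnorm_ge0 andbT; apply/ler_addgt0Pr => e e0; rewrite add0r.
  have e2 : 0 < e / 2 by rewrite divr_gt0.
  have [k kD hk] := hD _ e2.
  apply: le_trans (hnorm_trans k _ _) _; rewrite (splitr e) lerD//; last first.
    by rewrite hnorm_subC ltW.
  rewrite -{1}(cut_id mD kD) -cutB//.
  exact: le_trans (cut_le _ mD) (ltW hk).
Qed.

(** Almost disjointness is enough, which matters for closed intervals with a common endpoint such as
    [[0, t]] and [[t, +oo[]. *)
Lemma supp_dot0 D E f g : {ae mu, forall x, ~ (D x /\ E x)} ->
  supported D f -> supported E g -> dot f g = 0.
Proof.
move=> DE fD gE; apply: dot_ae0; apply: ae_imp3 DE fD gE => x nDE fx gx.
have [Dx|nDx] := pselect (D x); last by rewrite fx// mul0r.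
by rewrite gx ?rmorph0 ?mulr0// => Ex; exact: nDE.
Qed.

Lemma is_proj_cut D h : measurable D -> is_proj (supported D) h (L2cut D h).
Proof.
move=> mD; split; first exact: cut_supported.
move=> l lD; apply: dot_ae0.
apply: ae_imp3 (repB h (L2cut D h)) (rep_cut h mD) lD => x -> -> lx.
case: ifPn => [_|/negP]; first by rewrite subrr mul0r.
by rewrite inE => /lx ->; rewrite rmorph0 mulr0.
Qed.

Lemma orth_proj_supp D h : measurable D -> orth_proj (supported D) h = L2cut D h.
Proof. by move=> mD; apply: orth_projE (is_proj_cut _ mD); exact: supported_csub. Qed.

Lemma supportedS D E : D `<=` E -> supported D `<=` supported E.
Proof. by move=> DE h; apply: ae_imp => x hx nE; apply: hx => /DE. Qed.

Lemma ae_neq (t : R) : {ae mu, forall x, x <> t}.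
Proof.
exists [set t]; split => //; first exact: lebesgue_measure_set1.
by move=> x /= /contrapT.
Qed.

Lemma cut_compl D E h : measurable D ->
  supported (D `|` E) h -> supported E (h - L2cut D h).
Proof.
move=> mD hDE; apply: ae_imp3 (repB h (L2cut D h)) (rep_cut h mD) hDE => x -> -> hx nE.
case: ifPn => [_|/negP]; first by rewrite subrr.
by rewrite inE => nD; rewrite subr0 hx// => -[].
Qed.

Lemma tail_vanish h (e : R) : 0 < e ->
  \forall t \near +oo, hnorm (L2cut `[t, +oo[ h) < e.
Proof.
move: h e; apply: (csub_total (A := [set cindic ab.1 ab.2 | ab in setT])).
- apply: (@vanishing_csub R R +oo (fun t => L2cut `[t, +oo[) 1) => [t a f g|t h].
    by apply: cutL; exact: measurable_itv.
  by rewrite mul1r; apply: cut_le; exact: measurable_itv.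
- move=> _ [[a b] _ <-] /= e e0.
  near=> t; suff -> : L2cut `[t, +oo[ (cindic a b) = 0 by rewrite hnorm0.
  have mt : measurable (`[t, +oo[%classic : set (measurableTypeR R)) by exact: measurable_itv.
  apply/L2_eqP; apply: ae_imp3 (rep_cut (cindic a b) mt) (rep_toL2 (cindic_itv_in a b)) (@rep0 R).
  move=> x -> ex ->; rewrite ex indicE; case: ifPn => //.
  rewrite inE /= in_itv /= andbT => tx; rewrite memNset//= in_itv /= => /andP[_ xb].
  have : b < t by near: t; apply: nbhs_pinfty_gt; exact: num_real.
  by move=> bt; have := lt_le_trans bt (le_trans tx xb); rewrite ltxx.
- by move=> f fA; apply: cindic_total => a b; apply: fA; exists (a, b).
Unshelve. all: by end_near. Qed.

End Cut.

(** * Shifts *)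

Section Shift.
Context {R : realType}.
Local Notation mu := (@lebesgue_measure R).
Local Notation H := (L2 R).
Local Notation Re := (@complex.Re R).
Local Notation Im := (@complex.Im R).
Implicit Types (f g h k : H) (D E : set (measurableTypeR R)).

Definition addt (t : R) : measurableTypeR R -> measurableTypeR R := fun x => x + t.

Lemma measurable_addt t : measurable_fun setT (addt t).
Proof. by apply: measurable_funD => //; exact: measurable_cst. Qed.

HB.instance Definition _ t :=
  isMeasurableFun.Build _ _ _ _ (addt t) (measurable_addt t).

(** Lebesgue measure is determined by its values on the intervals []a, b]]. *)
Lemma lebesgue_measure_addt t D : measurable D -> pushforward mu (addt t) D = mu D.
Proof.
move=> mD; apply/esym/lebesgue_measure_unique => //= _ [[a b]] _ <-.
rewrite /pushforward.
have -> : addt t @^-1` [set` `]a, b]] = `](a - t), (b - t)]%classic.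
  by apply/seteqP; split => x /=; rewrite /addt !in_itv /= ltrBlDr lerBrDr.
rewrite /= !lebesgue_measure_itv/= !lte_fin ltrD2r; case: ifPn => // _.
by rewrite -!EFinD; congr EFin; ring.
Qed.

Lemma ge0_integral_addt t D (f : R -> \bar R) : measurable D ->
  measurable_fun D f -> (forall x, (0 <= f x)%E) ->
  (\int[mu]_(x in addt t @^-1` D) f (x + t)%R = \int[mu]_(x in D) f x)%E.
Proof.
move=> mD mf f0.
transitivity (\int[pushforward mu (addt t)]_(y in D) f y)%E.
  symmetry; apply: (ge0_integral_pushforward (measurable_addt t) mu mD mf).
  by move=> x _; exact: f0.
by apply: eq_measure_integral => A mA _; exact: lebesgue_measure_addt.
Qed.

Lemma cmeas_addt t (u : R -> R[i]) : cmeas u -> cmeas (fun x => u (x + t)).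
Proof.
move=> [mr mi]; split.
- exact: (measurableT_comp mr (measurable_addt t)).
- exact: (measurableT_comp mi (measurable_addt t)).
Qed.

Lemma ae_addt t (P : R -> Prop) : {ae mu, forall x, P x} -> {ae mu, forall x, P (x + t)}.
Proof.
move=> [N [mN N0 NP]]; exists (addt t @^-1` N); split.
- by rewrite -[X in measurable X]setTI; exact: measurable_addt.
- by rewrite -[RHS]N0 -[RHS](lebesgue_measure_addt t).
- by move=> x /= nP; apply: NP.
Qed.

Lemma L2_addt t (u : R -> R[i]) : u \in @L2pred R -> (fun x => u (x + t)) \in @L2pred R.
Proof.
move=> /L2predP[mu_ iu]; apply/L2predP; split; first exact: cmeas_addt.
have [m1 m2] := cmeas_addt t mu_.
apply/integrableP; split.
  by apply/measurable_EFinP; apply: measurable_funD; apply: measurable_funX.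
case/integrableP: iu => mm; rewrite -(ge0_integral_addt t)//.
by apply: measurableT_comp.
Qed.

Lemma rep_shift t h : {ae mu, forall x, rep (Sshift t h) x = rep h (x + t)}.
Proof. exact/rep_toL2/L2_addt/rep_in. Qed.

Lemma SshiftL t a f g : Sshift t (a *: f + g) = a *: Sshift t f + Sshift t g.
Proof.
apply/L2_eqP.
have e1 := repL a (Sshift t f) (Sshift t g); have e2 := ae_addt t (repL a f g).
have e3 := ae_imp2 (fun x => @conj _ _) (rep_shift t f) (rep_shift t g).
by apply: ae_imp4 e1 e2 e3 (rep_shift t (a *: f + g)) => x -> e [-> ->] ->.
Qed.

Lemma Sshift_add t f g : Sshift t (f + g) = Sshift t f + Sshift t g.
Proof. by rewrite -[f]scale1r SshiftL !scale1r. Qed.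

Lemma SshiftB t f g : Sshift t (f - g) = Sshift t f - Sshift t g.
Proof. by rewrite addrC -scaleN1r SshiftL scaleN1r addrC. Qed.

Lemma SshiftD t s h : Sshift t (Sshift s h) = Sshift (t + s) h.
Proof.
apply/L2_eqP; apply: ae_imp3 (rep_shift t (Sshift s h)) (ae_addt t (rep_shift s h)) (rep_shift (t + s) h).
by move=> x -> -> ->; rewrite addrA.
Qed.

Lemma Sshift0 h : Sshift 0 h = h.
Proof. by apply/L2_eqP; apply: ae_imp (rep_shift 0 h) => x ->; rewrite addr0. Qed.

Lemma SshiftK t : cancel (@Sshift R t) (Sshift (- t)).
Proof. by move=> h; rewrite SshiftD addNr Sshift0. Qed.

Lemma SshiftNK t : cancel (@Sshift R (- t)) (Sshift t).
Proof. by move=> h; rewrite SshiftD subrr Sshift0. Qed.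

Lemma nsq_shift t h : nsq (Sshift t h) = nsq h.
Proof.
have [m1 m2] := rep_cmeas h.
have mm : measurable_fun (setT : set (measurableTypeR R)) (fun x => (sqmod (rep h x))%:E).
  by apply/measurable_EFinP; apply: measurable_funD; apply: measurable_funX.
apply: EFin_inj; rewrite (nsq_ae (cmeas_addt t (rep_cmeas h)) (rep_shift t h)).
rewrite nsqE_ereal -(ge0_integral_addt t measurableT mm)// => x.
by rewrite lee_fin sqmod_ge0.
Qed.

Lemma hnorm_shift t h : hnorm (Sshift t h) = hnorm h.
Proof. exact/hnorm_eq/nsq_shift. Qed.

Lemma supported_shift t (D : set R) h : supported D h ->
  supported [set x | D (x + t)] (Sshift t h).
Proof.
by move=> hD; apply: ae_imp2 (rep_shift t h) (ae_addt t hD) => x -> + Dx; apply.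
Qed.

Lemma setT_csub : closed_subspace [set: H].
Proof. by []. Qed.

Lemma shift_isometry t : isometry_on [set: H] (Sshift t).
Proof. by split=> // *; rewrite ?SshiftL ?hnorm_shift. Qed.

Lemma dot_shift t f g : dot (Sshift t f) g = dot f (Sshift (- t) g).
Proof.
rewrite -{1}(SshiftNK t g).
exact: (isometry_on_dot setT_csub (shift_isometry t)).
Qed.

(** The indicator and its translate differ only within [|s|] of an endpoint, and the neighbourhoods
    of a and b have measure [2 |s|] each. *)
Lemma nsq_shift_cindic s a b : nsq (Sshift s (@cindic R a b) - @cindic R a b) <= 4 * `|s|.
Proof.
pose I (c : R) : set (measurableTypeR R) := `[(c - `|s|), (c + `|s|)]%classic.
have mI c : measurable (I c) by exact: measurable_itv.
have muI c : mu (I c) = (2 * `|s|)%:E.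
  rewrite /I /= lebesgue_measure_itv /= lte_fin -EFinD.
  case: ifPn => [_|]; first by congr EFin; ring.
  rewrite -leNgt => h; congr EFin; have := normr_ge0 s; lra.
rewrite -lee_fin nsqE_ereal.
have -> : (4 * `|s|)%:E = (mu (I a) + mu (I b))%E.
  by rewrite !muI -EFinD; congr EFin; ring.
rewrite -[I a]setIT -[I b]setIT -!integral_indic//.
have m1 c : measurable_fun (setT : set (measurableTypeR R)) (fun x => (\1_(I c) x)%:E).
  by apply/measurable_EFinP; exact: measurable_indic.
rewrite -ge0_integralD//.
have [p q] := rep_cmeas (Sshift s (cindic a b) - cindic a b).
apply: ae_ge0_le_integral => //.
- by move=> x _; rewrite lee_fin sqmod_ge0.
- by apply/measurable_EFinP; apply: measurable_funD; apply: measurable_funX.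
- by move=> x _; rewrite -EFinD lee_fin addr_ge0.
- by apply: emeasurable_funD.
have e1 := rep_toL2 (cindic_itv_in a b).
apply: ae_imp4 (repB (Sshift s (cindic a b)) (cindic a b)) (rep_shift s (cindic a b)) e1 (ae_addt s e1).
move=> x -> -> -> -> _; rewrite -EFinD lee_fin -rmorphB sqmodR !indicE.
(* A point further than [|s|] from c stays on the same side of c when moved by s. *)
have far c : ~ I c x -> (c < x + s) = (c < x).
  move=> /negP; rewrite /I /= in_itv /= negb_and -!ltNge => h.
  have h1 := ler_norm s; have h2 := ler_norm (- s); rewrite normrN in h2.
  by apply/idP/idP => ?; case/orP: h; lra.
have le1 (u v : bool) : (u%:R - v%:R) ^+ 2 <= 1 :> R.
  by case: u v => -[]; rewrite ?subrr ?subr0 ?sub0r ?sqrrN ?expr0n ?expr1n.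
have [xa|xa] := pselect (I a x).
  by apply: le_trans (le1 _ _) _; rewrite (mem_set xa) lerDl.
have [xb|xb] := pselect (I b x).
  by apply: le_trans (le1 _ _) _; rewrite (mem_set xb) lerDr.
rewrite (memNset xa) (memNset xb) addr0 !mem_setE !in_itv /= !(leNgt _ b).
by rewrite (far a)// (far b)// subrr expr0n.
Qed.

Lemma shift_near0 h (e : R) : 0 < e ->
  \forall s \near nbhs (0 : R), hnorm (Sshift s h - h) < e.
Proof.
move: h e; apply: (csub_total (A := [set @cindic R ab.1 ab.2 | ab in setT])).
- apply: (@vanishing_csub R R (nbhs (0 : R)) (fun s h => Sshift s h - h) 2) => [s a f g|s h].
    by rewrite SshiftL scalerBr opprD addrACA.
  by apply: le_trans (hnorm_leB _ _) _; rewrite hnorm_shift mulr_natl mulr2n.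
- move=> _ [[a b] _ <-] /= e e0.
  have e4 : 0 < e ^+ 2 / 4 by rewrite divr_gt0 ?exprn_gt0.
  near=> s.
  have s4 : `|s| < e ^+ 2 / 4 by near: s; exact: (@nbhs0_lt R R^o _ e4).
  rewrite -(ltr_pXn2r (n := 2)) ?nnegrE ?hnorm_ge0 ?(ltW e0)// hnorm_sqr.
  apply: le_lt_trans (nsq_shift_cindic _ _ _) _; by rewrite mulrC -ltr_pdivlMr.
- by move=> f fA; apply: cindic_total => a b; apply: fA; exists (a, b).
Unshelve. all: by end_near. Qed.

(** Since [S_s - S_t = S_t (S_{s-t} - 1)] and [S_t] is isometric, continuity at 0 is uniform in the
    two times. *)
Lemma shift_cvg h (e : R) : 0 < e ->
  exists2 d : R, 0 < d & forall s t, `|s - t| < d ->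
    hnorm (Sshift s h - Sshift t h) < e.
Proof.
move=> /(shift_near0 h)/nbhs_ballP[d d0 hd]; exists d => // s t st.
have := hd (s - t); rewrite /ball /= sub0r normrN => /(_ st).
by rewrite -(hnorm_shift t) SshiftB SshiftD [t + _]addrC subrK.
Qed.

End Shift.

(** * Injectivity of the Laplace transformation *)

Section Lerch.
Context {R : realType}.
Local Notation mu := (@lebesgue_measure R).
Context (f : R -> R).
Context (fi : mu.-integrable setT (EFin \o f)).
Context (f_lt0 : forall x, x < 0 -> f x = 0).
Context (fm : forall m : nat, \int[mu]_x (expR (- (m%:R * x)) * f x) = 0).

(** Bounds are asked on the positive half-line only, because f vanishes on the other; the
    exponentials used below are unbounded there. *)
Lemma integrable_bounded_mul (p : R -> R) C :
  measurable_fun (setT : set (measurableTypeR R)) p ->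
  (forall x, 0 <= x -> `|p x| <= C) ->
  mu.-integrable setT (EFin \o (fun x => p x * f x)).
Proof.
move=> mp pC; apply: (le_integrable measurableT _ _ (integrable_realZ C measurableT fi)).
  apply/measurable_EFinP; apply: measurable_funM => //.
  by apply/measurable_EFinP; case/integrableP: fi.
move=> x _ /=; rewrite lee_fin !normrM.
have [x0|x0] := ltP x 0; first by rewrite f_lt0// normr0 !mulr0.
by rewrite ler_wpM2r// (le_trans (pC _ x0))// ler_norm.
Qed.

(** This is [exp (n (a - x))], factored so that its K-th power is a constant times [exp (- K n x)],
    one of the kernels in [fm]. *)
Let y (n : nat) a x : R := expR (n%:R * a) * expR (- (n%:R * x)).

Let my n a : measurable_fun (setT : set (measurableTypeR R)) (y n a).
Proof.
apply: measurable_funM; first exact: measurable_cst.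
apply: (measurableT_comp (@measurable_expR R)).
by apply: measurable_funN; apply: measurable_funM => //; exact: measurable_cst.
Qed.

Let mexp (m : nat) : measurable_fun (setT : set (measurableTypeR R)) (fun x => expR (- (m%:R * x))).
Proof.
apply: (measurableT_comp (@measurable_expR R)).
by apply: measurable_funN; apply: measurable_funM => //; exact: measurable_cst.
Qed.

Let exp_le1 (m : nat) (x : R) : 0 <= x -> `|expR (- (m%:R * x))| <= 1.
Proof.
by move=> x0; rewrite ger0_norm ?expR_ge0// expR_le1 oppr_le0 mulr_ge0.
Qed.

Let S n a K (x : R) : R := series (exp_coeff (- y n a x)) K.

Let S_int n a K : mu.-integrable setT (EFin \o (fun x => S n a K x * f x)) /\
  \int[mu]_x (S n a K x * f x) = 0.
Proof.
elim: K => [|K [iK IK]].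
  have -> : (fun x => S n a 0 x * f x) = cst 0.
    by apply/funext => x; rewrite /S /series /= big_geq// mul0r.
  by split; [exact: integrable0|rewrite Rintegral_cst// mul0r].
pose c : R := (-1) ^+ K * expR (n%:R * a) ^+ K / K`!%:R.
have SE x : S n a K.+1 x * f x =
    S n a K x * f x + c * (expR (- ((K * n)%N%:R * x)) * f x).
  rewrite /S /series /= big_nat_recr //= mulrDl; congr (_ + _).
  have -> : expR (- ((K * n)%N%:R * x)) = expR (- (n%:R * x)) ^+ K.
    by rewrite -expRM_natl natrM mulrN mulrA.
  rewrite /exp_coeff /= /y /c (exprNn (_ * _)) (exprMn _ (expR _)).
  move: ((-1) ^+ K) (expR (n%:R * a) ^+ K) (expR (- (n%:R * x)) ^+ K) (K`!%:R^-1).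
  by move=> p q r s; ring.
have ie : mu.-integrable setT (EFin \o (fun x => expR (- ((K * n)%N%:R * x)) * f x)).
  exact: (integrable_bounded_mul (mexp _) (exp_le1 _)).
split.
  by under eq_fun do rewrite SE; apply: integrable_realD => //; exact: integrable_realZ.
under eq_Rintegral do rewrite SE.
by rewrite RintegralD// ?IK ?RintegralZl// ?fm ?mulr0 ?addr0//; exact: integrable_realZ.
Qed.

Let y_ge0 n a x : 0 <= y n a x.
Proof. by rewrite mulr_ge0 ?expR_ge0. Qed.

(** The bound grows doubly exponentially in n but does not depend on K. That is enough, because K
    tends to infinity first, for fixed n and a. *)
Let S_le n a K x : 0 <= x -> `|S n a K x| <= expR (expR (n%:R * a)).
Proof.
move=> x0; apply: (@le_trans _ _ (expR (y n a x))).
  apply: (@le_trans _ _ (series (exp_coeff (y n a x)) K)).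
    apply: le_trans (ler_norm_sum _ _ _) _; apply: ler_sum => k _.
    by rewrite /exp_coeff /= normrM normrX normrN ger0_norm// ger0_norm// invr_ge0.
  apply: nondecreasing_cvgn_le; last exact: is_cvg_series_exp_coeff.
  apply/nondecreasing_seqP => k; rewrite /series /= big_nat_recr//= lerDl.
  by rewrite /exp_coeff /= divr_ge0// exprn_ge0.
rewrite ler_expR /y ler_piMr ?expR_ge0//.
by have := exp_le1 n x0; rewrite ger0_norm ?expR_ge0.
Qed.

Let dominated_zero (p_ : nat -> R -> R) (p : R -> R) C :
  (forall n, measurable_fun (setT : set (measurableTypeR R)) (p_ n)) ->
  measurable_fun (setT : set (measurableTypeR R)) p ->
  (forall n x, 0 <= x -> `|p_ n x| <= C) ->
  (forall n, \int[mu]_x (p_ n x * f x) = 0) ->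
  {ae mu, forall x, p_ n x @[n --> \oo] --> p x} ->
  \int[mu]_x (p x * f x) = 0.
Proof.
move=> mp_ mp pC p0 pcv.
have mf : measurable_fun (setT : set (measurableTypeR R)) f.
  by apply/measurable_EFinP; case/integrableP: fi.
have [| | | | |_ _] := @dominated_convergence _ _ R mu setT measurableT
  (fun n x => (p_ n x * f x)%:E) (fun x => (p x * f x)%:E) (fun x => (C * `|f x|)%:E).
- by move=> n; apply/measurable_EFinP; exact: measurable_funM.
- by apply/measurable_EFinP; exact: measurable_funM.
- apply: ae_imp pcv => x cx _; apply: cvg_EFin; first exact: nearW.
  by apply: cvgMl.
- apply: integrable_realZ => //; apply: le_integrable fi => //.
    by apply/measurable_EFinP; exact: measurableT_comp.
  by move=> x _ /=; rewrite normr_id.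
- apply: aeW => x n _; rewrite /= lee_fin normrM.
  have [x0|x0] := ltP x 0; first by rewrite f_lt0// normr0 !mulr0.
  by rewrite ler_wpM2r// pC.
move=> cI; rewrite /Rintegral.
suff -> : (\int[mu]_x (p x * f x)%:E = 0)%E by [].
have e0 n : (\int[mu]_x (p_ n x * f x)%:E = 0)%E.
  rewrite -[LHS]fineK; first by rewrite [fine _]p0.
  apply: integrable_fin_num => //.
  exact: (integrable_bounded_mul (mp_ n) (pC n)).
have : (fun n => \int[mu]_x (p_ n x * f x)%:E)%E @ \oo --> 0%E.
  by under eq_fun do rewrite e0; exact: cvg_cst.
by move=> /cvg_lim <-//; apply/esym/cvg_lim.
Qed.

Let exp_int n a : \int[mu]_x (expR (- y n a x) * f x) = 0.
Proof.
apply: (dominated_zero (p_ := S n a) (C := expR (expR (n%:R * a)))).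
- move=> K; rewrite /S /series /=.
  apply: measurable_sum => k; rewrite /exp_coeff /=.
  apply: measurable_funM; last exact: measurable_cst.
  by apply: measurable_funX; apply: measurable_funN.
- by apply: (measurableT_comp (@measurable_expR R)); apply: measurable_funN.
- by move=> K x; exact: S_le.
- by move=> K; have [] := S_int n a K.
- by apply: aeW => x; exact: is_cvg_series_exp_coeff.
Qed.

Let gt_int a : \int[mu]_x (\1_(`]a, +oo[%classic) x * f x) = 0.
Proof.
apply: (dominated_zero (p_ := fun n x => expR (- y n a x)) (p := \1_(`]a, +oo[%classic)) (C := 1)) => //.
- by move=> n; apply: (measurableT_comp (@measurable_expR R)); apply: measurable_funN.
- by move=> n x _; rewrite ger0_norm ?expR_ge0// expR_le1 oppr_le0.
(* At x = a the sequence is constantly [exp (-1)], so this point is discarded. *)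
apply: ae_imp (ae_neq a) => x /eqP xa.
have yE n : y n a x = expR (a - x) ^+ n.
  by rewrite /y -expRD -expRM_natl mulrBr.
have [ax|] := ltP a x.
- rewrite indicE mem_set /= ?in_itv /= ?ax//.
  rewrite -(@expR0 R) -oppr0.
  have c : y n a x @[n --> \oo] --> (0 : R).
    under eq_fun do rewrite yE.
    by apply: cvg_expr; rewrite ger0_norm ?expR_ge0// expR_lt1 subr_lt0.
  by apply: (continuous_cvg _ (@continuous_expR R _)); exact: cvgN.
- rewrite le_eqVlt (negbTE xa) /= => {}xa.
  rewrite indicE memNset /= ?in_itv /= ?andbT; last by rewrite ltNge ltW.
  (* For x < a the quantity y grows geometrically, and [exp (- y) <= 1 / y] because
     [1 + y <= exp y]. *)
  apply: (@squeeze_cvgr _ _ _ _ (cst 0) (fun n => expR (x - a) ^+ n)).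
  + apply: nearW => n; rewrite expR_ge0 /=.
    have -> : expR (x - a) ^+ n = (y n a x)^-1 by rewrite yE -exprVn -expRN opprB.
    rewrite expRN lef_pV2 ?posrE ?expR_gt0 ?mulr_gt0 ?expR_gt0//.
    by apply: le_trans (expR_ge1Dx _); rewrite lerDr.
  + exact: cvg_cst.
  + by apply: cvg_expr; rewrite ger0_norm ?expR_ge0// expR_lt1 subr_lt0.
Qed.

Lemma lerch : {ae mu, forall x, f x = 0}.
Proof.
apply: ae0_itv_integrable => // a.
have mI : measurable (`]a, +oo[%classic : set (measurableTypeR R)) by exact: measurable_itv.
rewrite Rintegral_mkcond.
have -> : f \_ `]-oo, a] = (fun x => f x - \1_(`]a, +oo[%classic) x * f x).
  apply/funext => x; rewrite patchE indicE; case: (leP x a) => xa.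
    rewrite mem_set ?memNset /= ?in_itv /= ?andbT ?mul0r ?subr0//.
    by rewrite ltNge xa.
  rewrite memNset ?mem_set /= ?in_itv /= ?xa ?mul1r ?subrr//.
  by rewrite leNgt xa.
rewrite RintegralB//; last first.
  apply: (integrable_bounded_mul (C := 1)); first exact: measurable_indic.
  by move=> x _; rewrite indicE; case: (_ \in _); rewrite ?normr1 ?normr0.
rewrite gt_int subr0.
(* The moment of order 0 is the whole integral of f, so the half-line integrals on the left vanish
   with those on the right. *)
have := fm 0; under eq_Rintegral do rewrite mul0r oppr0 expR0 mul1r.
by [].
Qed.

End Lerch.

(** * The Laplace transformation as an inner product with exponentials *)

Section Laplace.
Context {R : realType}.
Local Notation mu := (@lebesgue_measure R).
Local Notation H := (L2 R).
Local Notation Re := (@complex.Re R).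
Local Notation Im := (@complex.Im R).
Implicit Types (f g h k : H) (l : R[i]).

Lemma cexpD (z w : R[i]) : cexp (z + w) = cexp z * cexp w.
Proof.
case: z w => [a b] [c d]; apply: complex_ext; rewrite ?cReM ?cImM /cexp /= expRD ?cosD ?sinD; ring.
Qed.

Lemma sqmod_cexp (z : R[i]) : sqmod (cexp z) = expR (Re z) ^+ 2.
Proof.
by rewrite /sqmod /cexp /= !exprMn -mulrDr cos2Dsin2 mulr1.
Qed.

Lemma sqmodJ (z : R[i]) : sqmod z^* = sqmod z.
Proof. by rewrite /sqmod cReJ cImJ sqrrN. Qed.

Lemma cexpR (x : R) : cexp x%:C%C = (expR x)%:C%C.
Proof. by rewrite /cexp /= cos0 sin0 mulr1 mulr0. Qed.

(* Conjugated so that [laplace h l] is the inner product of [h] with its class. *)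
Definition half_exp l (x : R) : R[i] :=
  if x \in `[0, +oo[%classic then (cexp (- (l * x%:C%C)))^* else 0.

Let mIoo : measurable (`[0, +oo[%classic : set (measurableTypeR R)).
Proof. exact: measurable_itv. Qed.

Lemma cmeas_cexp l : cmeas (fun x => cexp (- (l * x%:C%C))).
Proof.
have m (c : R) : measurable_fun (setT : set (measurableTypeR R)) (fun x => c * x).
  by apply: measurable_funM => //; exact: measurable_cst.
have mc p : measurable_fun (setT : set (measurableTypeR R)) (fun x => cos (p * x)).
  by apply: (measurableT_comp _ (m p)); apply: continuous_measurable_fun; exact: continuous_cos.
have ms p : measurable_fun (setT : set (measurableTypeR R)) (fun x => sin (p * x)).
  by apply: (measurableT_comp _ (m p)); apply: continuous_measurable_fun; exact: continuous_sin.
have me p : measurable_fun (setT : set (measurableTypeR R)) (fun x => expR (p * x)).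
  by apply: (measurableT_comp (@measurable_expR R) (m p)).
case: l => a b; split.
- have -> : Re \o (fun x => cexp (- ((a +i* b)%C * x%:C%C))) =
    (fun x => expR ((- a) * x) * cos ((- b) * x)).
    by apply/funext => x /=; congr (expR _ * cos _); ring.
  by apply: measurable_funM; [exact: me|exact: mc].
- have -> : Im \o (fun x => cexp (- ((a +i* b)%C * x%:C%C))) =
    (fun x => expR ((- a) * x) * sin ((- b) * x)).
    by apply/funext => x /=; congr (expR _ * sin _); ring.
  by apply: measurable_funM; [exact: me|exact: ms].
Qed.

Lemma half_exp_in l : 0 < Re l -> half_exp l \in @L2pred R.
Proof.
move=> l0.
have E0 : half_exp l = (fun x => (\1_(`[0, +oo[%classic) x)%:C%C * (cexp (- (l * x%:C%C)))^*).
  by apply/funext => x; rewrite /half_exp indicE; case: ifPn => _; rewrite ?mul1r ?mul0r.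
have mc : cmeas (half_exp l).
  rewrite E0; apply: cmeasM; last exact/cmeasJ/cmeas_cexp.
  by split; [exact: measurable_indic|exact: measurable_cst].
apply/L2predP; split => //.
(* The squared modulus of [half_exp l] is the exponential density of rate [2 Re l], divided by that
   rate. *)
have r0 : 0 < 2 * Re l by rewrite mulr_gt0.
have := integrable_realZ (2 * Re l)^-1 measurableT (integrable_exponential_pdf r0).
congr (_.-integrable _ _); apply/funext => x /=; congr EFin.
rewrite /half_exp /exponential_pdf patchE; case: ifPn => _; last by rewrite /sqmod /= expr0n addr0 mulr0.
rewrite sqmodJ sqmod_cexp mulrA mulVf ?gt_eqF// mul1r expr2 -expRD; congr expR.
by rewrite cReN cReM /=; ring.
Qed.

Definition Eexp l : H := toL2 (half_exp l).

Lemma laplaceE h l : 0 < Re l -> laplace h l = dot h (Eexp l).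
Proof.
move=> l0; have /L2predP[mE _] := half_exp_in l0.
have hh : {ae mu, forall x, rep h x = rep h x} by exact: aeW.
rewrite (dotE (rep_cmeas h) mE hh (rep_toL2 (half_exp_in l0))).
rewrite /laplace /cintegral; congr (_ +i* _)%C; rewrite [LHS]Rintegral_mkcond;
  apply: eq_Rintegral => x _; rewrite patchE /half_exp;
  by case: ifPn => _; rewrite ?conjCK ?rmorph0 ?mulr0//= mulrC.
Qed.

Lemma laplace_inj f g : past f -> past g ->
  (forall l, 0 < Re l -> laplace f l = laplace g l) -> f = g.
Proof.
move=> pf pg fg; apply/eqP; rewrite -subr_eq0; apply/eqP.
have : past (f - g) by apply: csubB => //; exact: supported_csub.
have : forall l, 0 < Re l -> dot (f - g) (Eexp l) = 0.
  by move=> l l0; rewrite dotBl -!laplaceE// fg// subrr.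
move: (f - g) => h h0 ph {f g pf pg fg}.
have expE (m : nat) x : half_exp (m.+1%:R%:C)%C x =
    (expR (- (m%:R * x)) * (\1_(`[0, +oo[%classic) x * expR (- x)))%:C%C.
  rewrite /half_exp indicE; case: ifPn => _; last by rewrite mul0r mulr0.
  rewrite mul1r -expRD -rmorphM -rmorphN cexpR; apply: complex_ext => //=; last by rewrite oppr0.
  by congr expR; rewrite -natr1; ring.
have n0 (m : nat) : 0 < Re (m.+1%:R%:C)%C by rewrite /= ltr0n.
(* At l = m + 1 the kernel factors as [exp (- m x)] times w. The weight w makes the square
   integrable h integrable, and the other factor supplies the moments of [lerch]. *)
pose w x := \1_(`[0, +oo[%classic) x * expR (- x) : R.
have part (p : R[i] -> R) :
    (forall z (c : R), p (z * c%:C%C) = p z * c) ->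
    (forall z, z = 0 -> p z = 0) ->
    (forall m, mu.-integrable setT (EFin \o (fun x => p (rep h x * (half_exp (m.+1%:R%:C)%C x)^*)))) ->
    (forall m, \int[mu]_x (p (rep h x * (half_exp (m.+1%:R%:C)%C x)^*)) = 0) ->
    {ae mu, forall x, p (rep h x) = 0}.
  move=> pM p0 pi pint.
  have pE m x : p (rep h x * (half_exp (m.+1%:R%:C)%C x)^*) =
      expR (- (m%:R * x)) * (w x * p (rep h x)).
    rewrite expE -/(w x); have -> : ((expR (- (m%:R * x)) * w x)%:C%C)^* = (expR (- (m%:R * x)) * w x)%:C%C :> R[i].
      by apply: complex_ext; rewrite ?cReJ ?cImJ //= oppr0.
    by rewrite pM mulrC mulrA.
  have : {ae mu, forall x, w x * p (rep h x) = 0}.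
    apply: lerch.
    - have := pi 0%N; under eq_fun do rewrite pE mul0r oppr0 expR0 mul1r.
      by [].
    - by move=> x x0; rewrite /w indicE memNset /= ?mul0r// in_itv /= andbT leNgt x0.
    - by move=> m; have := pint m; under eq_Rintegral do rewrite pE.
  apply: ae_imp2 ph => x hx; have [x0|x0] := pselect (`[0, +oo[%classic x); last by rewrite p0// hx.
  rewrite /w indicE mem_set// mul1r => /eqP; rewrite mulf_eq0 gt_eqF ?expR_gt0//=.
  by move/eqP.
have i m := cintegrable_mulJ (rep_in h) (half_exp_in (n0 m)).
have d m : cintegral setT (fun x => rep h x * (half_exp (m.+1%:R%:C)%C x)^*) = 0.
  rewrite -[RHS](h0 _ (n0 m)); symmetry; apply: dotE.
  - exact: rep_cmeas.
  - by have /L2predP[] := half_exp_in (n0 m).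
  - exact: aeW.
  - exact: rep_toL2 (half_exp_in (n0 m)).
have rh : {ae mu, forall x, Re (rep h x) = 0}.
  apply: part => //.
  - by move=> z c; rewrite cReM /= mulr0 subr0.
  - by move=> z ->.
  - by move=> m; have [] := i m.
  - by move=> m; have [] := d m.
have ih : {ae mu, forall x, Im (rep h x) = 0}.
  apply: part => //.
  - by move=> z c; rewrite cImM /= mulr0 add0r.
  - by move=> z ->.
  - by move=> m; have [] := i m.
  - by move=> m; have [] := d m.
by apply/L2_eqP; apply: ae_imp3 rh ih (@rep0 R) => x r0 i0 ->; exact: complex_ext.
Qed.

(** The shift is moved onto the exponential. On the positive half-line translation multiplies the
    exponential by a constant; the remainder lives on negative x and is orthogonal to h. *)
Lemma laplace_shift t h l : 0 <= t -> past h -> 0 < Re l ->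
  laplace (Sshift (- t) h) l = cexp (- (l * t%:C%C)) * laplace h l.
Proof.
move=> t0 ph l0; rewrite !laplaceE// dot_shift opprK.
pose c := (cexp (- (l * t%:C%C)))^*.
have -> : Sshift t (Eexp l) = c *: Eexp l + (Sshift t (Eexp l) - c *: Eexp l) by rewrite addrC subrK.
rewrite dotDr dotZr conjCK [X in _ + X](_ : _ = 0) ?addr0//.
apply: (supp_dot0 (D := `[0, +oo[%classic) (E := `]-oo, 0[%classic)) => //.
  by apply: aeW => x [] /=; rewrite !in_itv /= andbT leNgt => /negP.
have e1 := rep_toL2 (half_exp_in l0).
have e2 := ae_imp2 (fun x => @conj _ _) e1 (ae_addt t e1).
apply: ae_imp4 (repB (Sshift t (Eexp l)) (c *: Eexp l)) (repZ c (Eexp l)) (rep_shift t (Eexp l)) e2.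
move=> x -> -> -> [-> ->] /=; rewrite in_itv /= => /negP; rewrite -leNgt => x0.
rewrite /half_exp !mem_set /= ?in_itv /= ?andbT ?addr_ge0//.
have -> : cexp (- (l * (x + t)%:C%C)) = cexp (- (l * t%:C%C)) * cexp (- (l * x%:C%C)).
  by rewrite -cexpD rmorphD mulrDr opprD addrC.
by rewrite rmorphM subrr.
Qed.

Lemma past_csub : closed_subspace (@past R).
Proof. exact: supported_csub. Qed.

Lemma past_shift t h : 0 <= t -> past h -> past (Sshift (- t) h).
Proof.
move=> t0 ph; apply: supportedS (supported_shift (- t) ph) => x /=.
by rewrite !in_itv /= !andbT; lra.
Qed.

Lemma multiplier_shift (Theta : R[i] -> R[i]) (M : H -> H) t h :
  multiplier Theta M -> 0 <= t -> past h ->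
  M (Sshift (- t) h) = Sshift (- t) (M h).
Proof.
move=> [[Mp _ _] ML] t0 ph; have pS := past_shift t0 ph.
apply: laplace_inj; [exact: Mp|by apply: past_shift => //; exact: Mp|move=> l l0].
rewrite ML// !laplace_shift//; last exact: Mp.
by rewrite ML// mulrCA.
Qed.

End Laplace.

(** * Isometries and orthogonal complements *)

Section Images.
Context {R : realType}.
Local Notation H := (L2 R).
Local Notation Re := (@complex.Re R).
Implicit Types (K L : set H) (f g h k : H) (A : H -> H).

Lemma hnorm_small_eq f g : (forall e : R, 0 < e -> hnorm (f - g) < e) -> f = g.
Proof.
move=> fg; apply/eqP; rewrite -subr_eq0; apply/eqP/hnorm_eq0/eqP.
rewrite eq_le hnorm_ge0 andbT; apply/ler_addgt0Pr => e e0; rewrite add0r.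
exact/ltW/fg.
Qed.

Lemma isometry_on0 K A : closed_subspace K -> isometry_on K A -> A 0 = 0.
Proof.
by move=> cK [_ _ nA]; apply: hnorm_eq0; rewrite nA ?hnorm0//; exact: csub0.
Qed.

Lemma isometry_onB K A f g : closed_subspace K -> isometry_on K A -> K f -> K g ->
  A (f - g) = A f - A g.
Proof.
by move=> cK [_ lA _] Kf Kg; rewrite addrC -scaleN1r lA// scaleN1r addrC.
Qed.

Lemma isometry_onD K A f g : closed_subspace K -> isometry_on K A -> K f -> K g ->
  A (f + g) = A f + A g.
Proof. by move=> cK [_ lA _] Kf Kg; rewrite -[f]scale1r lA// !scale1r. Qed.

Lemma isometry_on_inj K A f g : closed_subspace K -> isometry_on K A -> K f -> K g ->
  A f = A g -> f = g.
Proof.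
move=> cK iA Kf Kg fg; apply/eqP; rewrite -subr_eq0; apply/eqP/hnorm_eq0.
case: (iA) => _ _ <-; last exact: csubB.
by rewrite (isometry_onB cK)// fg subrr hnorm0.
Qed.

(** An isometry reflects Cauchy sequences, so approximations in the image pull back to a convergent
    sequence in K. *)
Lemma image_csub K A : closed_subspace K -> isometry_on K A ->
  closed_subspace (A @` K).
Proof.
move=> cK iA; have [KA lA nA] := iA; split.
- by exists 0; [exact: csub0|exact: isometry_on0 iA].
- by move=> a _ _ [f Kf <-] [g Kg <-]; exists (a *: f + g); [exact: csubL|rewrite lA].
- move=> h hA.
  have /choice[u uP] n : exists k, K k /\ hnorm (h - A k) < n.+1%:R^-1.
    have n0 : 0 < n.+1%:R^-1 :> R by rewrite invr_gt0.
    by have [_ [k Kk <-] hk] := hA _ n0; exists k.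
  have uN (e : R) : 0 < e -> exists N, forall n, (N <= n)%N -> hnorm (h - A (u n)) < e.
    move=> e0; have [N _ HN] := near_infty_natSinv_lt (PosNum e0).
    by exists N => n Nn; apply: lt_trans (HN n Nn); have [] := uP n.
  have cu : hcauchy u.
    move=> e e0; have e2 : 0 < e / 2 by rewrite divr_gt0.
    have [N HN] := uN _ e2; exists N => m n Nm Nn.
    have [Km _] := uP m; have [Kn _] := uP n.
    rewrite -nA; last exact: csubB.
    rewrite (isometry_onB cK)// (splitr e); apply: le_lt_trans (hnorm_trans h _ _) _.
    by rewrite hnorm_subC ltrD// HN.
  have [k uk] := L2_complete cu.
  have Kk : K k by apply: csub_cvg uk => // n; have [] := uP n.
  exists k => //; apply/esym/hnorm_small_eq => e e0.
  have e2 : 0 < e / 2 by rewrite divr_gt0.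
  have [N HN] := uN _ e2; have [N' HN'] := uk _ e2.
  pose n := maxn N N'; have [Kn _] := uP n.
  rewrite (splitr e); apply: le_lt_trans (hnorm_trans (A (u n)) _ _) _.
  apply: ltrD; first by apply: HN; exact: leq_maxl.
  rewrite -(isometry_onB cK iA Kn Kk) (nA _ (csubB cK Kn Kk)); apply: HN'.
  exact: leq_maxr.
Qed.

Lemma ocompl_csub K L : closed_subspace K -> closed_subspace L ->
  closed_subspace (ocompl K L).
Proof.
move=> cK cL; split.
- by split; [exact: csub0|move=> l _; rewrite dot0l].
- move=> a f g [Kf fL] [Kg gL]; split; first exact: csubL.
  by move=> l Ll; rewrite dotL fL// gL// mulr0 addr0.
- move=> h hK; split.
    by case: (cK) => _ _; apply => e /hK[k [Kk _] hk]; exists k.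
  apply: (dot_orth cL) => l Ll.
  (* For k in the complement close to h, [Re (dot h l')] equals [Re (dot (h - k) l')], which is
     small by Cauchy-Schwarz. Passing to - l reverses the inequality; the added 1 covers l' = 0. *)
  have small (l' : H) : L l' -> Re (dot h l') <= 0.
    move=> Ll'; apply/ler_addgt0Pr => e e0; rewrite add0r.
    have e1 : 0 < e / (hnorm l' + 1) by rewrite divr_gt0// ltr_wpDl ?hnorm_ge0.
    have [k [_ kL] hk] := hK _ e1.
    rewrite -[h](subrK k) dotDl (kL _ Ll') addr0.
    apply: le_trans (Re_dot_le _ _) _.
    apply: le_trans (_ : e / (hnorm l' + 1) * (hnorm l' + 1) <= _).
      by apply: ler_pM; rewrite ?hnorm_ge0 ?(ltW hk)// lerDl.
    by rewrite divfK// gt_eqF// ltr_wpDl ?hnorm_ge0.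
  apply/eqP; rewrite eq_le small//=.
  by have := small _ (csubN cL Ll); rewrite dotNr cReN oppr_le0.
Qed.

Lemma ocompl_proj K L h : closed_subspace K -> closed_subspace L -> L `<=` K ->
  K h -> is_proj (ocompl K L) h (h - orth_proj L h).
Proof.
move=> cK cL LK Kh; have [Lp pP] := orth_projP cL h; split.
  by split; [apply: csubB => //; exact: LK|].
move=> k [_ kL]; rewrite opprB addrC subrK.
by apply: dot0C; exact: kL.
Qed.

Lemma pythagoras f g : dot f g = 0 -> nsq (f + g) = nsq f + nsq g.
Proof. by move=> fg; rewrite nsqD fg /= mulr0 addr0. Qed.

Lemma strongly_continuousP (I : set R) K (J : R -> H -> H) :
  strongly_continuous_on I K J <->
  forall h, K h -> forall t, I t -> forall e : R, 0 < e ->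
    exists2 d : R, 0 < d &
      forall s, I s -> `|s - t| < d -> hnorm (J s h - J t h) < e.
Proof.
split=> [JK h Kh t It e e0|JK h Kh t It].
  have /cvgrPdist_lt/(_ e e0) := JK h Kh t It.
  rewrite near_withinE => /nbhs_ballP[d d0 Hd]; exists d => // s Is st.
  have := Hd s; rewrite /ball /= distrC => /(_ st Is).
  by rewrite sub0r normrN ger0_norm ?hnorm_ge0.
apply/cvgrPdist_lt => e e0; rewrite near_withinE.
have [d d0 Hd] := JK h Kh t It e e0.
apply/nbhs_ballP; exists d => // s; rewrite /ball /= distrC => st Is.
by rewrite sub0r normrN ger0_norm ?hnorm_ge0// Hd.
Qed.

Lemma adjointE A g k : (forall h, dot (A h) g = dot h k) -> adjoint A g = k.
Proof.
move=> gk; rewrite /adjoint; case: xgetP => [k' _ gk'|/(_ k)//].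
apply/eqP; rewrite -subr_eq0; apply/eqP/nsq_eq0.
by rewrite /nsq dotBr -gk -gk' subrr.
Qed.

Lemma adjoint_shift t h : adjoint (Sshift t) h = Sshift (- t) h.
Proof. by apply: adjointE => f; exact: dot_shift. Qed.

End Images.

(** * The cocycle *)

Section Dilation.
Context {R : realType} (M : L2 R -> L2 R) (U : R -> L2 R -> L2 R).
Local Notation H := (L2 R).
Local Notation P := (@past R).
Local Notation F := (@future R 0).
Local Notation V := (M @` P).
Local Notation Vp := (ocompl P V).
Local Notation S := (@Sshift R).
Context (iM : isometry_on P M).
Context (MS : forall t h, 0 <= t -> P h -> M (S (- t) h) = S (- t) (M h)).
Context (hU : unitary_semigroup Vp U).
Implicit Types (f g h k v : H).

Let cP := @past_csub R.

Lemma subr_swap (A : zmodType) (a b c d : A) : a - b = c - d -> a - c = b - d.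
Proof.
by move=> e; rewrite -[a](subrK b) e addrAC [c - d - c]addrAC subrr sub0r addrC.
Qed.

Lemma future_csub t : closed_subspace (@future R t).
Proof. by apply: supported_csub; exact: measurable_itv. Qed.

Let cF : closed_subspace F := future_csub 0.

Lemma V_csub : closed_subspace V. Proof. exact: image_csub. Qed.

Lemma V_past : V `<=` P. Proof. by move=> _ [g Pg <-]; case: iM => + _ _; apply. Qed.

Lemma Vp_csub : closed_subspace Vp. Proof. exact: ocompl_csub V_csub. Qed.

Lemma past_future0 f g : P f -> F g -> dot f g = 0.
Proof.
apply: supp_dot0; apply: ae_imp (ae_neq 0) => x x0 [] /=; rewrite !in_itv /= andbT oppr0 => a b.
by apply: x0; apply/eqP; rewrite eq_le a b.
Qed.

Lemma past_decomp h : P (L2cut `[0, +oo[ h) /\ F (h - L2cut `[0, +oo[ h).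
Proof.
have mI : measurable (`[0, +oo[%classic : set (measurableTypeR R)) by exact: measurable_itv.
split; first exact: cut_supported.
apply: cut_compl => //; apply: aeW => x nx; exfalso; apply: nx.
by rewrite /= !in_itv /= andbT oppr0; have [?|/ltW] := leP 0 x; [left|right].
Qed.

Lemma proj_past_split f g : P f -> F g -> orth_proj P (f + g) = f.
Proof.
move=> Pf Fg; apply: (orth_projE cP); split => // l Pl.
by rewrite addrC addKr; apply/dot0C/past_future0.
Qed.

(** * Extension of M_Theta to the whole line *)

Definition Mext h : H := M (orth_proj P h) + (h - orth_proj P h).

Lemma Mext_split f g : P f -> F g -> Mext (f + g) = M f + g.
Proof. by move=> Pf Fg; rewrite /Mext proj_past_split// addrAC subrr add0r. Qed.

Lemma Mext_past f : P f -> Mext f = M f.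
Proof. by move=> Pf; rewrite -[f]addr0 Mext_split ?addr0//; exact: csub0. Qed.

Lemma Mext_future g : F g -> Mext g = g.
Proof.
by move=> Fg; rewrite -[g]add0r Mext_split ?(isometry_on0 cP iM)//; exact: csub0.
Qed.

Lemma split_past_future h : exists f g, [/\ P f, F g & h = f + g].
Proof.
have [a b] := past_decomp h; exists (L2cut `[0, +oo[ h), (h - L2cut `[0, +oo[ h).
by split => //; rewrite addrC subrK.
Qed.

Lemma Mext_isometry : isometry_on [set: H] Mext.
Proof.
have [Mp lM nM] := iM; split => // [a h h' _ _|h _].
- have [f [g [Pf Fg ->]]] := split_past_future h; have [f' [g' [Pf' Fg' ->]]] := split_past_future h'.
  have -> : a *: (f + g) + (f' + g') = (a *: f + f') + (a *: g + g').
    by rewrite scalerDr addrACA.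
  rewrite !Mext_split//; try exact: csubL.
  by rewrite lM// scalerDr addrACA.
- have [f [g [Pf Fg ->]]] := split_past_future h; rewrite Mext_split//; apply: hnorm_eq.
  rewrite !pythagoras; [|exact: past_future0|apply: past_future0 => //; exact: Mp].
  by rewrite -!hnorm_sqr nM.
Qed.

Lemma Vp_Mext v h : Vp v -> dot v (Mext h) = 0.
Proof.
move=> [Pv vV]; have [f [g [Pf Fg ->]]] := split_past_future h.
by rewrite Mext_split// dotDr vV ?past_future0 ?addr0//; exists f.
Qed.

Lemma past_split h : P h -> exists v g, [/\ Vp v, P g & h = v + M g].
Proof.
move=> Ph; have [pV _] := ocompl_proj cP V_csub V_past Ph.
have [[g Pg gE] _] := orth_projP V_csub h.
by exists (h - orth_proj V h), g; rewrite gE subrK.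
Qed.

Lemma split_Vp_Mext h : exists v k, Vp v /\ h = v + Mext k.
Proof.
have [f [g [Pf Fg ->]]] := split_past_future h; have [v [k [Vv Pk ->]]] := past_split Pf.
by exists v, (k + g); rewrite Mext_split// addrA.
Qed.

Lemma projVp v h : Vp v -> orth_proj Vp (v + Mext h) = v.
Proof.
move=> Vv; apply: (orth_projE Vp_csub); split => // l Vl.
by rewrite addrC addKr; apply/dot0C/Vp_Mext.
Qed.

(** The second coordinate in the orthogonal sum of Vp and the range of [Mext]: it exists by
    [split_Vp_Mext] and is unique because [Mext] is injective. *)
Definition Mext_inv h : H := xget 0 [set k | h = orth_proj Vp h + Mext k].

Lemma Mext_invE v k : Vp v -> Mext_inv (v + Mext k) = k.
Proof.
move=> Vv; rewrite /Mext_inv; case: xgetP => [k' _|/(_ k)]; last by rewrite /= projVp.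
rewrite projVp// => /addrI kk'.
by apply/esym; apply: (isometry_on_inj (@setT_csub R) Mext_isometry).
Qed.

(* For [0 <= t] this is [W_{-t} S_{-t}], by [Wneg_Wsh] below. *)
Definition Wsh (t : R) h : H := U t (orth_proj Vp h) + Mext (S (- t) (Mext_inv h)).

Lemma WshE t v k : Vp v -> Wsh t (v + Mext k) = U t v + Mext (S (- t) k).
Proof. by move=> Vv; rewrite /Wsh (projVp k Vv) (Mext_invE k Vv). Qed.

Local Opaque Mext Mext_inv Wsh hnorm dot Sshift orth_proj.

Lemma Wsh_Vp t v : Vp v -> Wsh t v = U t v.
Proof.
move=> Vv; rewrite -[v in LHS]addr0 -(isometry_on0 (@setT_csub R) Mext_isometry) (WshE _ _ Vv).
by rewrite (isometry_on0 (@setT_csub R) (shift_isometry _)) (isometry_on0 (@setT_csub R) Mext_isometry) addr0.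
Qed.

Lemma U_isometry t : 0 <= t -> isometry_on Vp (U t).
Proof. by move=> t0; have [[iU _ _ _] _] := hU; exact: iU. Qed.

Lemma U_in t v : 0 <= t -> Vp v -> Vp (U t v).
Proof. by move=> /U_isometry[Uin _ _]; exact: Uin. Qed.

Lemma Wsh_Mext t k : 0 <= t -> Wsh t (Mext k) = Mext (S (- t) k).
Proof.
move=> t0; rewrite -[Mext k]add0r WshE; last exact: csub0 Vp_csub.
by rewrite (isometry_on0 Vp_csub (U_isometry t0)) add0r.
Qed.

(** The commutation of M with right shifts turns the transported shift into the plain one on V. *)
Lemma Wsh_M t g : 0 <= t -> P g -> Wsh t (M g) = S (- t) (M g).
Proof.
move=> t0 Pg; rewrite -(Mext_past Pg) Wsh_Mext// !Mext_past//; last exact: past_shift.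
exact: MS.
Qed.

Lemma nsq_Vp_Mext v k : Vp v -> nsq (v + Mext k) = nsq v + nsq k.
Proof.
move=> Vv; rewrite pythagoras ?Vp_Mext//; congr (_ + _).
by case: Mext_isometry => _ _ nN; rewrite -!hnorm_sqr nN.
Qed.

Lemma Wsh_isometry t : 0 <= t -> isometry_on [set: H] (Wsh t).
Proof.
move=> t0; have [Uin lU nU] := U_isometry t0; have [_ lN _] := Mext_isometry.
split => // [a h h' _ _|h _].
- have [v [k [Vv ->]]] := split_Vp_Mext h; have [v' [k' [Vv' ->]]] := split_Vp_Mext h'.
  have -> : a *: (v + Mext k) + (v' + Mext k') = (a *: v + v') + Mext (a *: k + k').
    by rewrite lN// scalerDr addrACA.
  rewrite (WshE _ _ (csubL Vp_csub a Vv Vv')) (WshE _ _ Vv) (WshE _ _ Vv').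
  by rewrite lU// SshiftL lN// (scalerDr a (U t v)) addrACA.
- have [v [k [Vv ->]]] := split_Vp_Mext h; rewrite (WshE _ _ Vv); apply: hnorm_eq.
  rewrite (nsq_Vp_Mext _ Vv) (nsq_Vp_Mext _ (Uin _ Vv)).
  by rewrite nsq_shift -!hnorm_sqr nU.
Qed.

(** Each summand is covered: [U t] is onto Vp, and the bilateral shift has the inverse [S t]. *)
Lemma Wsh_surj t h : 0 <= t -> exists k, Wsh t k = h.
Proof.
move=> t0; have [v [k [Vv ->]]] := split_Vp_Mext h.
have [_ /(_ t t0)[_ /(_ v Vv)[v' Vv' <-]]] := hU.
by exists (v' + Mext (S t k)); rewrite (WshE _ _ Vv') SshiftK.
Qed.

Lemma Wsh0 h : Wsh 0 h = h.
Proof.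
have [v [k [Vv ->]]] := split_Vp_Mext h; rewrite (WshE _ _ Vv) oppr0 Sshift0.
by have [[_ U0 _ _] _] := hU; rewrite U0.
Qed.

Lemma Wsh_add s t h : 0 <= s -> 0 <= t -> Wsh (s + t) h = Wsh s (Wsh t h).
Proof.
move=> s0 t0; have [v [k [Vv ->]]] := split_Vp_Mext h; rewrite !(WshE _ _ Vv) (WshE _ _ (U_in t0 Vv)).
have [[_ _ UD _] _] := hU; rewrite (UD _ _ _ s0 t0 Vv) SshiftD.
by rewrite opprD.
Qed.

Lemma Wsh_inj t h k : 0 <= t -> Wsh t h = Wsh t k -> h = k.
Proof. by move=> t0; exact: (isometry_on_inj (@setT_csub R) (Wsh_isometry t0)). Qed.

Lemma hnorm_Wsh t h : 0 <= t -> hnorm (Wsh t h) = hnorm h.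
Proof. by move=> /Wsh_isometry[_ _]; apply. Qed.

Lemma Wsh_sub t h k : 0 <= t -> Wsh t (h - k) = Wsh t h - Wsh t k.
Proof. by move=> t0; exact: (isometry_onB (@setT_csub R) (Wsh_isometry t0)). Qed.

Lemma Wsh_cont h t (e : R) : 0 <= t -> 0 < e -> exists2 d : R, 0 < d &
  forall s, 0 <= s -> `|s - t| < d -> hnorm (Wsh s h - Wsh t h) < e.
Proof.
move=> t0 e0; have [v [k [Vv ->]]] := split_Vp_Mext h.
have e2 : 0 < e / 2 by rewrite divr_gt0.
have It : `[0, +oo[%classic t by rewrite /= in_itv /= t0.
have [[_ _ _ /strongly_continuousP Uc] _] := hU.
have [d d0 Hd] := Uc v Vv t It _ e2.
have [d' d'0 Hd'] := shift_cvg k e2.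
exists (Num.min d d'); first by rewrite lt_min d0.
move=> s s0; rewrite lt_min => /andP[sd sd'].
rewrite !(WshE _ _ Vv) opprD addrACA (splitr e); apply: le_lt_trans (hnorm_leD _ _) _.
apply: ltrD; first by apply: Hd => //=; rewrite in_itv /= s0.
rewrite -(isometry_onB (@setT_csub R) Mext_isometry)//.
case: Mext_isometry => _ _ -> //; apply: Hd'.
by rewrite -opprD normrN.
Qed.

(** Let p be the part of f beyond t. [S t] carries f - p and g into the negative half-line, where
    [Mext] is the identity, and keeps p in the positive one, where it splits as a + M b. So [S t h]
    has the coordinates a and b + S t (f - p) + S t g. After shifting back, commutation turns
    [M (S (- t) b)] into [S (- t) (M b)], the middle term of [Wpast]. *)
Lemma Wneg_Wsh t h : 0 <= t -> Wneg M U t h = Wsh t (S t h).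
Proof.
move=> t0.
have mt : measurable (`[t, +oo[%classic : set (measurableTypeR R)) by exact: measurable_itv.
have m0t : measurable (`[0, t]%classic : set (measurableTypeR R)) by exact: measurable_itv.
have [f [g [Pf Fg hfg]]] := split_past_future h.
have pF : orth_proj F h = g.
  apply: (orth_projE cF); split => // l Fl.
  by rewrite hfg addrK; exact: past_future0.
have pP : orth_proj P h = f by rewrite hfg (proj_past_split Pf Fg).
pose p := L2cut `[t, +oo[ f.
have pp : orth_proj (supported `[t, +oo[) f = p by exact: orth_proj_supp.
have supp_p : supported `[t, +oo[ p by exact: cut_supported.
have supp_q : supported `[0, t] (f - p).
  apply: cut_compl => //; apply: supportedS Pf => x /=; rewrite !in_itv /= !andbT => x0.
  by rewrite x0 /=; have [?|/ltW] := leP t x; [left|right].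
have pq : orth_proj (supported `[0, t]) f = f - p.
  apply: (orth_projE (supported_csub m0t)); split => // l ll.
  rewrite opprB addrC subrK.
  apply: supp_dot0 supp_p ll; apply: ae_imp (ae_neq t) => x xt [] /=; rewrite !in_itv /= andbT.
  by move=> tx /andP[_ xt']; apply: xt; apply/eqP; rewrite eq_le tx xt'.
have PSp : P (S t p).
  apply: supportedS (supported_shift t supp_p) => x /=.
  by rewrite !in_itv /= !andbT lerDr.
have FSq : F (S t (f - p)).
  apply: supportedS (supported_shift t supp_q) => x /=.
  by rewrite !in_itv /= => /andP[_]; rewrite oppr0 gerDr.
have FSg : F (S t g).
  apply: supportedS (supported_shift t Fg) => x /=.
  by rewrite !in_itv /= oppr0; lra.
have Pq : P (f - p).
  by apply: supportedS supp_q => x /=; rewrite !in_itv /= andbT => /andP[].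
have [a [b [Va Pb Sp]]] := past_split PSp.
have pa : orth_proj Vp (S t p) = a by rewrite Sp -(Mext_past Pb) (projVp b Va).
have pb : orth_proj V (S t p) = M b.
  apply: (orth_projE V_csub); split; first by exists b.
  by move=> l Vl; rewrite Sp addrK; case: Va => _; apply.
rewrite /Wneg /Wpast pF pP pp pq pa pb.
have -> : S t h = a + Mext (b + (S t (f - p) + S t g)).
  rewrite (Mext_split Pb (csubD cF FSq FSg)) [RHS]addrA -Sp.
  by rewrite -!Sshift_add [p + _]addrA [p + _]addrC subrK hfg.
rewrite (WshE _ _ Va) !Sshift_add !SshiftK [S (- t) b + _]addrA.
have PSb := past_shift t0 Pb.
rewrite (Mext_split (csubD cP PSb Pq) Fg) (isometry_onD cP iM PSb Pq) (MS t0 Pb).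
by rewrite !addrA.
Qed.

(** * The family W_t for both signs of t *)

Lemma Wfam_neg t h : 0 <= t -> Wfam M U (- t) h = Wsh t (S t h).
Proof. by move=> t0; rewrite /Wfam oppr_le0 t0 opprK Wneg_Wsh. Qed.

(** If x solves [Wsh t x = S (- t) h], then isometry of [Wsh t] identifies the value of the adjoint
    as [S (- t) x], and the outer shift in [Wfam] restores x. *)
Lemma Wfam_pos t h : 0 < t -> Wsh t (Wfam M U t h) = S (- t) h.
Proof.
move=> t0; rewrite /Wfam leNgt t0 /=; have t0' := ltW t0.
have [x xE] := Wsh_surj (S (- t) h) t0'.
have -> : adjoint (Wneg M U t) (S (- t) h) = S (- t) x.
  apply: adjointE => f; rewrite -xE (Wneg_Wsh _ t0').
  rewrite (isometry_on_dot (@setT_csub R) (Wsh_isometry t0'))//.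
  exact: dot_shift.
by rewrite SshiftNK.
Qed.

Local Opaque Wfam.

(* Determines [Wfam] for both signs of [t] at once, without inverses, since
   [Wsh c] is injective. *)
Lemma Wsh_Wfam c t h : 0 <= c -> t <= c ->
  Wsh c (Wfam M U t h) = Wsh (c - t) (S (- t) h).
Proof.
move=> c0 tc; have [t0|t0] := ltP 0 t.
  have {1}-> : c = (c - t) + t by rewrite subrK.
  have ct : 0 <= c - t by rewrite subr_ge0.
  by rewrite (Wsh_add _ ct (ltW t0)) (Wfam_pos _ t0).
have nt : 0 <= - t by rewrite oppr_ge0.
by rewrite -{1}[t]opprK (Wfam_neg _ nt) -(Wsh_add _ c0 nt).
Qed.

Let absP (t : R) : 0 <= `|t| /\ t <= `|t|.
Proof. by split; rewrite ?normr_ge0 ?ler_norm. Qed.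

Lemma Wfam_unitary t : unitary_on [set: H] (Wfam M U t).
Proof.
have [c0 tc] := absP t; have ct : 0 <= `|t| - t by rewrite subr_ge0.
have [_ lG nG] := Wsh_isometry c0; have [_ lG' _] := Wsh_isometry ct.
split=> [|y _].
  split=> // [a f g _ _|h _].
    apply: (Wsh_inj c0); rewrite lG// !(Wsh_Wfam _ c0 tc) SshiftL.
    by rewrite lG'.
  by rewrite -(hnorm_Wsh _ c0) (Wsh_Wfam _ c0 tc) (hnorm_Wsh _ ct) hnorm_shift.
have [x xE] := Wsh_surj (Wsh `|t| y) ct.
exists (S t x); first exact: I.
apply: (Wsh_inj c0).
by rewrite (Wsh_Wfam _ c0 tc) SshiftK.
Qed.

Lemma Wfam0 h : Wfam M U 0 h = h.
Proof. by rewrite -oppr0 Wfam_neg// Wsh0 Sshift0. Qed.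

Lemma WfamD t s h :
  Wfam M U (t + s) h = Wfam M U t (S t (Wfam M U s (adjoint (S t) h))).
Proof.
rewrite adjoint_shift.
have [t0 tc] := absP t; have [s0 sc] := absP s.
(* This c lets [Wsh_Wfam] apply to t + s and t at c, and to s at c - t. Both sides become
   [Wsh (c - t - s)] of [S (- t - s) h]. *)
have c0 : 0 <= `|t| + `|s| by rewrite addr_ge0.
have h1 : t + s <= `|t| + `|s| by exact: lerD.
have h2 : t <= `|t| + `|s| by rewrite ler_wpDr.
have h3 : 0 <= `|t| + `|s| - t by rewrite subr_ge0.
have h4 : s <= `|t| + `|s| - t by rewrite lerBrDr addrC; exact: lerD.
apply: (Wsh_inj c0); rewrite (Wsh_Wfam _ c0 h1) (Wsh_Wfam _ c0 h2) SshiftK (Wsh_Wfam _ h3 h4).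
by rewrite SshiftD !opprD addrA [- s - t]addrC.
Qed.

Lemma Wfam_cont : strongly_continuous_on setT [set: H] (Wfam M U).
Proof.
apply/strongly_continuousP => h _ t _ e e0.
have e2 : 0 < e / 2 by rewrite divr_gt0.
(* One c serves all s within 1 of t. Applying the isometry [Wsh c] reduces the claim to continuity
   of the shift and of [Wsh]. *)
have [c0 tc] := absP t; pose c := `|t| + 1.
have ct : 0 <= c - t by rewrite /c; lra.
have [d d0 Hd] := shift_cvg h e2.
have [d' d'0 Hd'] := Wsh_cont (S (- t) h) ct e2.
exists (Num.min 1 (Num.min d d')); first by rewrite !lt_min ltr01 d0.
move=> s _; rewrite !lt_min => /and3P[s1 sd sd'].
have cc : 0 <= c by rewrite /c addr_ge0.
have sc : s <= c by move: (ler_norm (s - t)); rewrite /c; lra.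
have cs : 0 <= c - s by rewrite subr_ge0.
have tc' : t <= c by rewrite -subr_ge0.
rewrite -(hnorm_Wsh (Wfam M U s h - Wfam M U t h) cc).
rewrite (Wsh_sub (Wfam M U s h) (Wfam M U t h) cc) (Wsh_Wfam _ cc sc) (Wsh_Wfam _ cc tc').
rewrite (splitr e).
apply: le_lt_trans (hnorm_trans (Wsh (c - s) (S (- t) h)) _ _) _.
apply: ltrD.
  rewrite -(Wsh_sub _ _ cs) (hnorm_Wsh _ cs); apply: Hd.
  by rewrite -opprD normrN.
apply: Hd' => //; rewrite opprB addrC addrA subrK.
by rewrite distrC.
Qed.

(** Both f and [S (- t) f] live on the negative half-line, where [Mext] is the identity. Hence
    [Wsh t f = S (- t) f], which is also [Wsh t (W_t f)]. *)
Lemma Wfam_markov t f : 0 < t -> future t f -> Wfam M U t f = f.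
Proof.
move=> t0 ff; have t0' := ltW t0; apply: (Wsh_inj t0'); rewrite (Wfam_pos _ t0).
have Ff : F f.
  by apply: supportedS ff => x /=; rewrite !in_itv /= oppr0 => /le_trans; apply; rewrite oppr_le0.
have FS : F (S (- t) f).
  by apply: supportedS (supported_shift (- t) ff) => x /=; rewrite !in_itv /= oppr0; lra.
by rewrite -{2}(Mext_future Ff) (Wsh_Mext _ t0') (Mext_future FS).
Qed.

(** [W_{-t}] and M agree on functions supported in [[0, t]], so only the tail of h beyond t
    contributes, with norm at most twice that of the tail. *)
Lemma Wfam_cvg h : P h ->
  hnorm (Wfam M U (- t) h - M h) @[t --> +oo] --> (0 : R).
Proof.
move=> Ph; apply/cvgrPdist_lt => e e0.
have e2 : 0 < e / 2 by rewrite divr_gt0.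
near=> t; rewrite sub0r normrN ger0_norm ?hnorm_ge0//.
have t0 : 0 <= t by near: t; apply: nbhs_pinfty_ge; exact: num_real.
have pe : hnorm (L2cut `[t, +oo[ h) < e / 2 by near: t; exact: tail_vanish.
have mt : measurable (`[t, +oo[%classic : set (measurableTypeR R)) by exact: measurable_itv.
pose p := L2cut `[t, +oo[ h.
have Pp : P p.
  apply: supportedS (cut_supported h mt) => x /=; rewrite !in_itv /= !andbT.
  exact: le_trans.
have supp_q : supported `[0, t] (h - p).
  apply: cut_compl => //; apply: supportedS Ph => x /=; rewrite !in_itv /= !andbT => x0.
  by rewrite x0 /=; have [?|/ltW] := leP t x; [left|right].
have Pq : P (h - p) by exact: csubB.
have FSq : F (S t (h - p)).
  apply: supportedS (supported_shift t supp_q) => x /=.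
  by rewrite !in_itv /= => /andP[_]; rewrite oppr0 gerDr.
have Wq : Wfam M U (- t) (h - p) = M (h - p).
  by rewrite (Wfam_neg _ t0) -(Mext_future FSq) (Wsh_Mext _ t0) SshiftK (Mext_past Pq).
have -> : Wfam M U (- t) h - M h = Wfam M U (- t) p - M p.
  have [iW _] := Wfam_unitary (- t).
  have := Wq; rewrite (isometry_onB (f := h) (g := p) (@setT_csub R) iW I I).
  rewrite (isometry_onB cP iM Ph Pp).
  exact: subr_swap.
rewrite (splitr e); apply: le_lt_trans (hnorm_leB _ _) _.
have [[_ _ nW] _] := Wfam_unitary (- t); have [_ _ nM] := iM.
by rewrite nW// nM// ltrD.
Unshelve. all: by end_near. Qed.

(** * The semigroup W_{-t} T_t and its Wold decomposition *)

Let J t h := Wfam M U (- t) (Tshift t h).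

Lemma J_Wsh t h : 0 <= t -> J t h = Wsh t h.
Proof. by move=> t0; rewrite /J /Tshift (Wfam_neg _ t0) SshiftNK. Qed.

Lemma Wsh_isometry_semigroup K : closed_subspace K ->
  (forall t, 0 <= t -> forall h, K h -> K (Wsh t h)) -> isometry_semigroup K J.
Proof.
move=> cK KG; split.
- move=> t t0; have [_ lG nG] := Wsh_isometry t0; split.
  + by move=> h Kh; rewrite J_Wsh//; exact: KG.
  + by move=> a f g _ _; rewrite !(J_Wsh _ t0) (lG _ _ _ I I).
  + by move=> h _; rewrite (J_Wsh _ t0) (nG _ I).
- by move=> h _; rewrite (J_Wsh _ (lexx 0)) Wsh0.
- move=> s t h s0 t0 _.
  by rewrite (J_Wsh _ (addr_ge0 s0 t0)) (J_Wsh _ t0) (J_Wsh _ s0) (Wsh_add _ s0 t0).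
- apply/strongly_continuousP => h Kh t; rewrite /= in_itv /= andbT => t0 e e0.
  have [d d0 Hd] := Wsh_cont h t0 e0; exists d => // s; rewrite /= in_itv /= andbT => s0 st.
  by rewrite !J_Wsh//; exact: Hd.
Qed.

(** With this double complement, the reducing conditions for Vp and for V are the same two
    invariances. *)
Lemma ocompl_Vp h : ocompl P Vp h <-> V h.
Proof.
split=> [[Ph hVp]|Vh].
  have [v [g [Vv Pg hE]]] := past_split Ph.
  suff v0 : v = 0 by rewrite hE v0 add0r; exists g.
  apply: nsq_eq0; have := hVp _ Vv; rewrite hE dotDl -(Mext_past Pg).
  by rewrite (dot0C (Vp_Mext g Vv)) addr0 /nsq => ->.
split; first exact: V_past.
by move=> v [_ vV]; apply/dot0C/vV.
Qed.

Lemma Wsh_Vperp t h : 0 <= t -> Vp h -> Vp (Wsh t h).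
Proof. by move=> t0 Vh; rewrite Wsh_Vp//; exact: U_in. Qed.

Lemma Wsh_V t h : 0 <= t -> V h -> V (Wsh t h).
Proof.
move=> t0 [g Pg <-]; rewrite Wsh_M// -MS//.
by exists (S (- t) g) => //; exact: past_shift.
Qed.

Lemma Wsh_past t h : 0 <= t -> P h -> P (Wsh t h).
Proof.
move=> t0 Ph; have [v [g [Vv Pg ->]]] := past_split Ph.
have [_ lG _] := Wsh_isometry t0.
rewrite -[v]scale1r lG//; apply: csubL => //.
- by have [] := Wsh_Vperp t0 Vv.
- by apply: V_past; apply: Wsh_V => //; exists g.
Qed.

Lemma wold : wold_decomposition P J Vp V.
Proof.
split.
- by apply: (Wsh_isometry_semigroup cP) => t t0 h; exact: Wsh_past.
- exact: Vp_csub.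
- exact: V_csub.
- by move=> f g [_ fV] /fV.
- apply/seteqP; split => [h Ph|_ [f [Pf _] [g Vg <-]]].
    have [v [g [Vv Pg ->]]] := past_split Ph.
    by exists v => //; exists (M g) => //; exists g.
  by apply: csubD => //; exact: V_past.
- move=> t t0; split; first by move=> h [].
  + by move=> h; rewrite J_Wsh//; exact: Wsh_Vperp.
  + by move=> h /ocompl_Vp Vh; apply/ocompl_Vp; rewrite J_Wsh//; exact: Wsh_V.
- move=> t t0; split; first exact: V_past.
  + by move=> h; rewrite J_Wsh//; exact: Wsh_V.
  + by move=> h; rewrite J_Wsh//; exact: Wsh_Vperp.
- have iJ := Wsh_isometry_semigroup Vp_csub (fun t t0 h => @Wsh_Vperp t h t0); split => // t t0.
  have [iJt _ _ _] := iJ; split; first exact: iJt.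
  move=> k Vk; have [_ /(_ t t0)[_ /(_ k Vk)[h Vh <-]]] := hU.
  by exists h => //; rewrite J_Wsh// Wsh_Vp.
- by apply: (Wsh_isometry_semigroup V_csub) => t t0 h; exact: Wsh_V.
- move=> L cL redL [_ uL]; apply/seteqP; split => [h Lh|_ ->]; last exact: csub0.
  apply: hnorm_small_eq => e e0; rewrite subr0.
  near (+oo : set_system R) => t.
  have t0 : 0 <= t by near: t; apply: nbhs_pinfty_ge; exact: num_real.
  have pe : hnorm (L2cut `[t, +oo[ h) < e by near: t; exact: tail_vanish.
  suff <- : L2cut `[t, +oo[ h = h by [].
  apply: cut_id; first exact: measurable_itv.
  (* Surjectivity on L gives h = J t k with k in L, hence in V, where J t is the right shift. So h
     is supported in [[t, +oo[] and equals its own tail. *)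
  have [_ /(_ h Lh)[k Lk <-]] := uL t t0.
  have [LV _ _] := redL t t0; have [g Pg <-] := LV _ Lk.
  rewrite J_Wsh// Wsh_M//; have PMg : P (M g) by apply: V_past; exists g.
  by apply: supportedS (supported_shift (- t) PMg) => x /=; rewrite !in_itv /= !andbT subr_ge0.
Unshelve. all: by end_near. Qed.

End Dilation.

Local Open Scope complex_scope.

Theorem theorem3p1 (R : realType) (Theta : R[i] -> R[i]) (M : L2 R -> L2 R)
    (U : R -> L2 R -> L2 R) :
  inner_function Theta -> multiplier Theta M ->
  let V := M @` past in
  let Vperp := ocompl past V in
  unitary_semigroup Vperp U ->
  let W := Wfam M U in
  let J := fun (t : R) (h : L2 R) => W (- t) (Tshift t h) in
  [/\ markovian_cocycle W,
      forall h, past h -> hnorm (W (- t) h - M h) @[t --> +oo] --> (0 : R),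
      wold_decomposition past J Vperp V &
      forall (t : R) h, 0 <= t -> Vperp h -> J t h = U t h].
Proof.
move=> _ mM V Vperp hU W J.
have iM := mM.1; have MS t h := @multiplier_shift R Theta M t h mM.
split.
- split; last by move=> t t0 f; exact: (Wfam_markov iM MS hU t0).
  split.
  + exact: (Wfam_unitary iM MS hU).
  + exact: (Wfam_cont iM MS hU).
  + exact: (Wfam0 iM MS hU).
  + exact: (WfamD iM MS hU).
- by move=> h Ph; exact: (Wfam_cvg iM MS hU Ph).
- exact: (wold iM MS hU).
- move=> t h t0 Vh; transitivity (Wsh M U t h); first exact: J_Wsh.
  exact: Wsh_Vp.
Qed.
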